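(* Let $(M,F)$ be a complete generalized isotropic Berwald manifold, i.e. a complete Finsler manifold for which there are functions $\mu=\mu(x,y)$ and $\lambda=\lambda(x,y)$ on $TM_0$, homogeneous in $y$ of degrees $0$ and $-1$ respectively, with $$B^i_{\ jkl}=\mu\, C_{jkl}\,\ell^i+\lambda\,(h^i_j h_{kl}+h^i_k h_{jl}+h^i_l h_{jk}),$$ and suppose that $\mu$ is bounded. If $F$ has vanishing stretch curvature, i.e. $\Sigma_{ijkl}=0$, then $F$ is a Landsberg metric, i.e. $L_{ijk}=0$.
   Context: $M$ is an $n$-dimensional $C^\infty$ manifold and $TM_0=TM\setminus\{0\}$ is the slit tangent bundle, with standard local coordinates $(x^i,y^i)$. A Finsler metric is a function $F:TM\to[0,\infty)$ that is $C^\infty$ on $TM_0$, positively $1$-homogeneous on the fibers, and such that $g_{ij}=\frac12\frac{\partial^2 F^2}{\partial y^i\partial y^j}$ is positive definite at every $y\in T_xM\setminus\{0\}$. Indices are lowered and raised with $g_{ij}$ and its inverse $g^{ij}$. Homogeneity is positive homogeneity in $y$. Notation: $y_i=g_{ij}y^j$; $\ell^i=y^i/F$; $h_{ij}=g_{ij}-F^{-2}y_iy_j$, $h^i_j=\delta^i_j-F^{-2}y^iy_j$; Cartan torsion $C_{ijk}=\frac12\frac{\partial g_{ij}}{\partial y^k}$; spray coefficients $G^i=\frac14 g^{il}\{\frac{\partial^2F^2}{\partial x^k\partial y^l}y^k-\frac{\partial F^2}{\partial x^l}\}$; Berwald curvature $B^i_{\ jkl}=\frac{\partial^3G^i}{\partial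 y^j\partial y^k\partial y^l}$. The symbol ''$|$'' denotes horizontal covariant derivative with respect to the Berwald connection: with $\delta_k=\frac{\partial}{\partial x^k}-\frac{\partial G^m}{\partial y^k}\frac{\partial}{\partial y^m}$ and $G^m_{ik}=\frac{\partial^2G^m}{\partial y^i\partial y^k}$, one has $T^i_{\ j|k}=\delta_kT^i_{\ j}+T^m_{\ j}G^i_{mk}-T^i_{\ m}G^m_{jk}$, and analogously for other tensors. Landsberg curvature: $L_{ijk}=C_{ijk|s}y^s$. Stretch curvature: $\Sigma_{ijkl}=2(L_{ijk|l}-L_{ijl|k})$. Geodesics are the curves satisfying $\ddot c^i+2G^i(c,\dot c)=0$. ''Complete'' means that every geodesic is defined on all of $(-\infty,\infty)$. ''$\mu$ bounded'' means $\sup_{TM_0}|\mu|<\infty$. *)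

(* Defs.v *)
From mathcomp Require Import all_boot all_order all_algebra.
From mathcomp Require Import all_classical all_reals all_analysis.

Set Implicit Arguments.
Unset Strict Implicit.
Unset Printing Implicit Defensive.

Import Order.TTheory GRing.Theory Num.Theory.
Import numFieldNormedType.Exports.

Local Open Scope classical_set_scope.
Local Open Scope ring_scope.

(* In finite dimension, f is C^(k+1) iff it is (Fréchet) differentiable and all
   its directional derivatives are C^k. *)
Fixpoint Ck (R : realType) (V W : normedModType R) (k : nat) (U : set V)
    (f : V -> W) : Prop :=
  if k is k'.+1 then
    (forall x, U x -> differentiable f x) /\
    (forall v, Ck k' U (fun x => 'D_v f x))
  else forall x, U x -> {for x, continuous f}.

Definition smooth (R : realType) (V W : normedModType R) (U : set V)
  (f : V -> W) : Prop := forall k, Ck k U f.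

(* A smooth manifold given by an atlas indexed by [chart]. [chart_map a] and
   [chart_inv a] are total functions; only their values on [chart_dom a], respectively on
   [chart_map a @` chart_dom a], are meaningful. *)
Record manifold (R : realType) (n : nat) := Manifold {
  carrier :> topologicalType;
  carrier_hausdorff : hausdorff_space carrier;
  carrier_second_countable : second_countable (T := carrier);
  chart : Type;
  chart_dom : chart -> set carrier;
  chart_map : chart -> carrier -> 'rV[R]_n;
  chart_inv : chart -> 'rV[R]_n -> carrier;
  dom_cover : forall p, exists a, chart_dom a p;
  dom_open : forall a, open (chart_dom a);
  image_open : forall a, open (chart_map a @` chart_dom a);
  chart_mapK : forall a p, chart_dom a p -> chart_inv a (chart_map a p) = p;
  chart_map_continuous : forall a p, chart_dom a p -> {for p, continuous (chart_map a)};
  chart_inv_continuous : forall a x, (chart_map a @` chart_dom a) x ->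
    {for x, continuous (chart_inv a)};
  transition_smooth : forall a b,
    smooth (chart_map a @` (chart_dom a `&` chart_dom b)) (chart_map b \o chart_inv a)
}.

Section TangentBundle.
Context {R : realType} {n : nat} {M : manifold R n}.
Implicit Types (p : M) (a b : chart M) (y : 'rV[R]_n).

(* A tangent vector at p is the family of its components in all the charts
   around p, related by the differentials of the transition maps. Setting the
   components in the other charts to 0 makes the family unique. *)
Record tangent p := Tangent {
  tcomp : chart M -> 'rV[R]_n;
  tcomp_out : forall a, ~ chart_dom a p -> tcomp a = 0;
  tcomp_trans : forall a b, chart_dom a p -> chart_dom b p ->
    tcomp b = 'D_(tcomp a) (chart_map b \o chart_inv a) (chart_map a p)
}.

Lemma transition_diff a b p : chart_dom a p -> chart_dom b p ->
  differentiable (chart_map b \o chart_inv a) (chart_map a p).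
Proof.
move=> pa pb; have [H _] := transition_smooth a b 1%N.
by apply: H; exists p.
Qed.

Lemma transition_chain a b c p y : chart_dom a p -> chart_dom b p -> chart_dom c p ->
  'D_y (chart_map c \o chart_inv a) (chart_map a p) =
  'D_('D_y (chart_map b \o chart_inv a) (chart_map a p)) (chart_map c \o chart_inv b) (chart_map b p).
Proof.
move=> pa pb pc.
have dab := transition_diff pa pb.
have ab : (chart_map b \o chart_inv a) (chart_map a p) = chart_map b p by rewrite /= chart_mapK.
have dbc : differentiable (chart_map c \o chart_inv b)
    ((chart_map b \o chart_inv a) (chart_map a p)) by rewrite ab; exact: transition_diff.
rewrite -ab (deriveE _ dbc) (deriveE _ dab).
rewrite -[RHS]/(('d (chart_map c \o chart_inv b) ((chart_map b \o chart_inv a) (chart_map a p)) \o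
  'd (chart_map b \o chart_inv a) (chart_map a p)) y) -(diff_comp dab dbc).
rewrite -deriveE; last exact: differentiable_comp.
apply: near_eq_derive.
have pax : {for chart_map a p, continuous (chart_inv a)}.
  by apply: chart_inv_continuous; exists p.
have : nbhs (chart_inv a (chart_map a p)) (chart_dom b).
  by rewrite chart_mapK//; apply: open_nbhs_nbhs; split => //; exact: dom_open.
by move=> /pax /= bnear; near do rewrite /= chart_mapK//.
Unshelve. all: by end_near.
Qed.

Definition tscale p (t : R) (v : tangent p) : tangent p.
Proof.
refine (@Tangent p (fun a => t *: tcomp v a) _ _).
- by move=> a pa; rewrite tcomp_out// scaler0.
- move=> a b pa pb; have dab := transition_diff pa pb.
  by rewrite (tcomp_trans v pa pb) !deriveE// linearZ.
Defined.

Definition tzero p : tangent p.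
Proof.
refine (@Tangent p (fun=> 0) _ _) => // a b pa pb.
by rewrite derive0.
Defined.

Definition tvec_comp a p y b : 'rV[R]_n :=
  if `[< chart_dom a p /\ chart_dom b p >]
  then 'D_y (chart_map b \o chart_inv a) (chart_map a p) else 0.

(* y^i d/dx^i at p in the chart a; the zero vector when p is not in chart_dom a *)
Definition tvec a p y : tangent p.
Proof.
refine (@Tangent p (tvec_comp a p y) _ _); rewrite /tvec_comp.
- by move=> b pb; case: asboolP => // -[].
- move=> b c pb pc; have [pa|npa] := pselect (chart_dom a p).
    by rewrite !asboolT//; exact: transition_chain.
  by rewrite !asboolF ?derive0// => -[].
Defined.

Definition tfun := forall p, tangent p -> R.

Definition local (f : tfun) a (z : 'rV[R]_n * 'rV[R]_n) : R :=
  f (chart_inv a z.1) (tvec a (chart_inv a z.1) z.2).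

Definition slit a : set ('rV[R]_n * 'rV[R]_n) :=
  [set z | (chart_map a @` chart_dom a) z.1 /\ z.2 <> 0].

Definition slit_homogeneous (m : int) (f : tfun) : Prop :=
  forall p (v : tangent p) (t : R), v <> tzero p -> 0 < t ->
    f p (tscale t v) = t ^ m * f p v.

End TangentBundle.

Arguments tfun {R n} M.

(* The tensors below are written in the coordinates z = (x, y) of a chart,
   F being the local expression of the Finsler metric. *)
Section LocalTensors.
Context {R : realType} {n : nat}.
Local Notation V := ('rV[R]_n * 'rV[R]_n)%type.

Definition dx (i : 'I_n) (f : V -> R) (z : V) : R := 'D_(delta_mx 0 i, 0) f z.
Definition dy (i : 'I_n) (f : V -> R) (z : V) : R := 'D_(0, delta_mx 0 i) f z.

Variable F : V -> R.
Implicit Types (i j k l m s : 'I_n) (z : V).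

Definition F2 z : R := F z ^+ 2.
Definition ycoord i z : R := z.2 0 i.

Definition gmetric i j z : R := 2^-1 * dy i (dy j F2) z.
Definition ginv i j z : R := invmx (\matrix_(i < n, j < n) gmetric i j z) i j.
Definition ylow i z : R := \sum_j gmetric i j z * ycoord j z.
Definition ell i z : R := ycoord i z / F z.
Definition hlow i j z : R := gmetric i j z - F z ^- 2 * ylow i z * ylow j z.
Definition hmix i j z : R := (i == j)%:R - F z ^- 2 * ycoord i z * ylow j z.
Definition cartan i j k z : R := 2^-1 * dy k (gmetric i j) z.

Definition spray i z : R :=
  4^-1 * \sum_l ginv i l z *
    (\sum_k dx k (dy l F2) z * ycoord k z - dx l F2 z).
Definition berwald i j k l : V -> R := dy j (dy k (dy l (spray i))).

Definition hdelta k (f : V -> R) z : R :=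
  dx k f z - \sum_m dy k (spray m) z * dy m f z.
Definition connection m i k : V -> R := dy i (dy k (spray m)).

(* T_{ijk|s} *)
Definition hcov3 (T : 'I_n -> 'I_n -> 'I_n -> V -> R) i j k s z : R :=
  hdelta s (T i j k) z
  - \sum_m T m j k z * connection m i s z
  - \sum_m T i m k z * connection m j s z
  - \sum_m T i j m z * connection m k s z.

Definition landsberg i j k z : R := \sum_s hcov3 cartan i j k s z * ycoord s z.
Definition stretch i j k l z : R :=
  2 * (hcov3 landsberg i j k l z - hcov3 landsberg i j l k z).

End LocalTensors.

Section Finsler.
Context {R : realType} {n : nat} {M : manifold R n}.
Variable F : tfun M.

Record finsler : Prop := {
  finsler_ge0 : forall p (v : tangent p), 0 <= F v;
  finsler_smooth : forall a, smooth (slit a) (local F a);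
  finsler_homogeneous : forall p (v : tangent p) (t : R), 0 < t ->
    F (tscale t v) = t * F v;
  finsler_posdef : forall a z, slit a z -> forall u : 'rV[R]_n, u <> 0 ->
    0 < \sum_i \sum_j gmetric (local F a) i j z * u 0 i * u 0 j
}.

(* The equation is imposed at each time in every chart around c t. As c is
   continuous and I is open, [chart_map a \o c] is meaningful near such t. *)
Definition geodesic (I : set R) (c : R -> M) : Prop :=
  forall t, I t -> {for t, continuous c} /\
    forall a, chart_dom a (c t) ->
      let x := chart_map a \o c in
      [/\ derivable x t 1, derivable (derive1 x) t 1 &
        forall i, derive1 (derive1 x) t 0 i +
          2 * spray (local F a) i (x t, derive1 x t) = 0].

Definition complete_finsler : Prop :=
  forall (I : set R) (c : R -> M), I !=set0 -> open I -> is_interval I ->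
    geodesic I c ->
    exists c' : R -> M, geodesic setT c' /\ forall t, I t -> c' t = c t.

Definition generalized_isotropic_berwald (mu lambda : tfun M) : Prop :=
  [/\ slit_homogeneous 0 mu, slit_homogeneous (-1) lambda &
  forall a z, slit a z -> forall i j k l,
    let Fa := local F a in
    berwald Fa i j k l z =
      local mu a z * cartan Fa j k l z * ell Fa i z +
      local lambda a z * (hmix Fa i j z * hlow Fa k l z +
                          hmix Fa i k z * hlow Fa j l z +
                          hmix Fa i l z * hlow Fa j k z)].

Definition bounded_slit (f : tfun M) : Prop :=
  exists K : R, forall p (v : tangent p), v <> tzero p -> `|f p v| <= K.

Definition vanishing_stretch : Prop :=
  forall a z, slit a z -> forall i j k l, stretch (local F a) i j k l z = 0.

Definition landsberg_metric : Prop :=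
  forall a z, slit a z -> forall i j k, landsberg (local F a) i j k z = 0.

End Finsler.

(* Main.v *)
From HB Require Import structures.
Require Import Defs.
From mathcomp Require Import all_boot all_order all_algebra.
From mathcomp Require Import all_classical all_reals all_analysis.
From mathcomp Require Import ring lra.

(** Write E = F^2, and let a prime denote the covariant derivative along a
    geodesic, so that L = C' by definition of the Landsberg curvature.

    In a chart, repeated vertical differentiation of the equation that defines the
    spray gives L_jkl = - y_i B^i_jkl / 2 ([landsbergE]). Contracting the hypothesis
    on the Berwald curvature with y_i kills its angular part and leaves
    L = f C with f = - mu F / 2 ([landsberg_isotropic]). Vanishing stretch makes
    L_jkl|s symmetric in l and s; contracting with y^s, and using that L annihilates
    y while y is horizontally constant, one gets L' = 0 along geodesics
    ([landsberg_transport]).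

    Suppose that L does not vanish at some tangent vector, and follow the geodesic c
    with this initial velocity. At time 0 one has C = L / f, hence
    C = (t + 1/f) L at all times t, both sides having the same derivative. By
    completeness the time t = - 1/f is attained; there C = 0, so L = f C = 0, and
    L vanishes all along c because it is parallel: a contradiction.

    The equality of tensors along c is expressed without parallel transport. The
    combinations of C and L with coefficients affine in t whose covariant derivative
    is zero solve, in every chart, a linear homogeneous system, so that their zeros
    form an open set of times; it is closed as well ([combination_zero]). The charts
    along c are compared through the transformation of C alone, since L = f C.

    Three facts about geodesics are needed. A geodesic exists for every non-zero
    initial velocity: the spray system is solved in one chart by Picard iteration
    ([picard], [local_flow]), and the geodesic equation holds in the other charts by
    its Euler-Lagrange form ([geodesic_transfer]). A geodesic satisfies the spray
    system in every chart. And its velocity never vanishes, so that it stays where E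
    is smooth: E is constant along c, its derivative being zero also at an instant
    of zero velocity, where E is quadratically small ([velocity_neq0]). *)

Set Implicit Arguments.
Unset Strict Implicit.
Unset Printing Implicit Defensive.

Import Order.TTheory GRing.Theory Num.Theory.
Import numFieldNormedType.Exports.

Local Open Scope classical_set_scope.
Local Open Scope ring_scope.

(** * Calculus of smooth functions on an open set *)

Section SmoothFunctions.
Context {R : realType} {V : normedModType R}.
Implicit Types (U : set V) (f g : V -> R) (x u v : V) (k : nat).

Lemma open_nearE U x (P : V -> Prop) : open U -> U x ->
  (forall y, U y -> P y) -> \forall y \near x, P y.
Proof. by move=> oU Ux PU; apply: filterS (open_nbhs_nbhs (conj oU Ux)). Qed.

Lemma derive_congr U f g x v : open U -> U x ->
  (forall y, U y -> f y = g y) -> 'D_v f x = 'D_v g x.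
Proof. by move=> oU Ux fg; apply: near_eq_derive; exact: open_nearE oU Ux fg. Qed.

(** The differential is obtained by choice from the values of the function
    everywhere, so that locality has to be proved; a function vanishing near x
    is the case from which the general one follows by subtraction. *)
Lemma differentiable_near0 f x : (\forall y \near x, f y = 0) -> differentiable f x.
Proof.
move=> f0; have fx0 : f x = 0 by exact: nbhs_singleton f0.
apply/diffP; apply: (@getPex _ (fun df : {linear V -> R} => continuous df /\
  forall y, f y = f (lim (nbhs x)) + df (y - lim (nbhs x))
                  +o_(y \near x) (y - lim (nbhs x)))).
exists (\0 : {linear V -> R}); split; first by move=> ?; exact: cst_continuous.
move=> y; rewrite littleoE; first by rewrite addrC subrK.
move=> _/posnumP[e]; near=> z; rewrite /= lim_id // fx0 add0r subr0.
by rewrite (near f0 z) // normr0 mulr_ge0.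
Unshelve. all: by end_near. Qed.

Lemma differentiable_congr U f g x : open U -> U x ->
  (forall y, U y -> f y = g y) -> differentiable f x -> differentiable g x.
Proof.
move=> oU Ux fg df; rewrite -(subrK f g); apply: differentiableD => //.
apply: differentiable_near0; apply: open_nearE oU Ux _ => y Uy.
by rewrite !fctE fg // subrr.
Qed.

Lemma Ck_congr k U f g : open U -> (forall y, U y -> f y = g y) ->
  Ck k U f -> Ck k U g.
Proof.
elim: k f g => [|k IH] f g oU fg /=.
  move=> cf x Ux; have := cf x Ux; rewrite /prop_for /continuous_at -(fg x Ux).
  by apply: cvg_trans; apply: near_eq_cvg; exact: open_nearE oU Ux fg.
case=> df Df; split=> [x Ux|v].
  exact: differentiable_congr oU Ux fg (df x Ux).
by apply: IH (Df v) => // y Uy; exact: derive_congr oU Uy fg.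
Qed.

Lemma CkW k U f : Ck k.+1 U f -> Ck k U f.
Proof.
elim: k f => [|k IH] f [df Df] /=; first by move=> x /df /differentiable_continuous.
by split=> // v; apply: IH; exact: Df.
Qed.

Lemma Ck_cst k U (c : R) : Ck k U (cst c : V -> R).
Proof.
elim: k c => [|k IH] c /=; first by move=> x _; exact: cst_continuous.
split=> // v; suff -> : (fun x => 'D_v (cst c : V -> R) x) = cst 0 by exact: IH.
by apply/funext => x; rewrite derive_cst.
Qed.

Lemma Ck_add k U f g : open U -> Ck k U f -> Ck k U g -> Ck k U (f \+ g).
Proof.
move=> oU; elim: k f g => [|k IH] f g /=.
  by move=> cf cg x Ux; apply: continuousD; [exact: cf|exact: cg].
move=> [df Df] [dg Dg]; split=> [x Ux|v].
  exact: differentiableD (df x Ux) (dg x Ux).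
apply: (Ck_congr oU) (IH _ _ (Df v) (Dg v)) => y Uy /=.
by rewrite -deriveD //; apply: diff_derivable; [exact: df|exact: dg].
Qed.

Lemma Ck_mul k U f g : open U -> Ck k U f -> Ck k U g -> Ck k U (f \* g).
Proof.
move=> oU; elim: k f g => [|k IH] f g.
  by move=> cf cg x Ux; apply: continuousM; [exact: cf|exact: cg].
move=> Cf Cg; have [df Df] := Cf; have [dg Dg] := Cg; split=> [x Ux|v].
  exact: differentiableM (df x Ux) (dg x Ux).
apply: (Ck_congr oU) (Ck_add oU (IH _ _ (CkW Cf) (Dg v)) (IH _ _ (CkW Cg) (Df v))).
move=> y Uy /=; rewrite (deriveM (f := f) (g := g)) //; apply: diff_derivable.
  exact: df.
exact: dg.
Qed.

Lemma Ck_inv k U f : open U -> (forall x, U x -> f x != 0) -> Ck k U f ->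
  Ck k U (fun x => (f x)^-1).
Proof.
move=> oU f0; elim: k f f0 => [|k IH] f f0.
  by move=> cf x Ux; apply: continuousV; [exact: f0|exact: cf].
move=> Cf; have [df Df] := Cf; split=> [x Ux|v].
  by apply: differentiableV; [exact: df|exact: f0].
have Ci := IH _ f0 (CkW Cf).
have := Ck_mul oU (Ck_mul oU (Ck_cst k U (-1)) (Ck_mul oU Ci Ci)) (Df v).
apply: (Ck_congr oU) => y Uy /=.
rewrite (deriveV (f := f)) ?f0 //; last by apply: diff_derivable; exact: df.
by rewrite -exprVn expr2 mulN1r.
Qed.

Lemma smooth_congr U f g : open U -> (forall y, U y -> f y = g y) ->
  smooth U f -> smooth U g.
Proof. by move=> oU fg sf k; exact: Ck_congr oU fg (sf k). Qed.

Lemma smooth_derive U f v : smooth U f -> smooth U (fun x => 'D_v f x).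
Proof. by move=> sf k; have [_] := sf k.+1; apply. Qed.

Lemma smooth_differentiable U f x : smooth U f -> U x -> differentiable f x.
Proof. by move=> sf Ux; have [+ _] := sf 1%N; apply. Qed.

Lemma smooth_derivable U f x v : smooth U f -> U x -> derivable f x v.
Proof. by move=> sf Ux; apply: diff_derivable; exact: smooth_differentiable sf Ux. Qed.

Lemma smooth_continuous U f x : smooth U f -> U x -> {for x, continuous f}.
Proof. by move=> sf; exact: sf 0%N x. Qed.

Lemma smooth_cst U (c : R) : smooth U (fun _ : V => c).
Proof. by move=> k; exact: Ck_cst. Qed.

Lemma smooth_add U f g : open U -> smooth U f -> smooth U g ->
  smooth U (fun x => f x + g x).
Proof. by move=> oU sf sg k; exact: Ck_add. Qed.

Lemma smooth_mul U f g : open U -> smooth U f -> smooth U g ->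
  smooth U (fun x => f x * g x).
Proof. by move=> oU sf sg k; exact: Ck_mul. Qed.

Lemma smooth_sub U f g : open U -> smooth U f -> smooth U g ->
  smooth U (fun x => f x - g x).
Proof.
move=> oU sf sg; apply: smooth_congr (oU) _ (smooth_add oU sf
  (smooth_mul oU (smooth_cst U (-1)) sg)) => y _.
by rewrite mulN1r.
Qed.

Lemma smooth_inv U f : open U -> (forall x, U x -> f x != 0) -> smooth U f ->
  smooth U (fun x => (f x)^-1).
Proof. by move=> oU f0 sf k; exact: Ck_inv. Qed.

Lemma smooth_sum (I : Type) (r : seq I) (P : pred I) U (f : I -> V -> R) :
  open U -> (forall i, smooth U (f i)) ->
  smooth U (fun x => \sum_(i <- r | P i) f i x).
Proof.
move=> oU sf; elim: r => [|i r IH].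
  by apply: smooth_congr (oU) _ (smooth_cst U 0) => y _; rewrite big_nil.
have [Pi|nPi] := boolP (P i).
  apply: smooth_congr (oU) _ (smooth_add oU (sf i) IH) => y _.
  by rewrite big_cons Pi.
by apply: smooth_congr (oU) _ IH => y _; rewrite big_cons (negbTE nPi).
Qed.

Lemma smooth_prod (I : Type) (r : seq I) (P : pred I) U (f : I -> V -> R) :
  open U -> (forall i, smooth U (f i)) ->
  smooth U (fun x => \prod_(i <- r | P i) f i x).
Proof.
move=> oU sf; elim: r => [|i r IH].
  by apply: smooth_congr (oU) _ (smooth_cst U 1) => y _; rewrite big_nil.
have [Pi|nPi] := boolP (P i).
  apply: smooth_congr (oU) _ (smooth_mul oU (sf i) IH) => y _.
  by rewrite big_cons Pi.
by apply: smooth_congr (oU) _ IH => y _; rewrite big_cons (negbTE nPi).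
Qed.

Lemma smooth_linear U f : linear f -> continuous f -> smooth U f.
Proof.
move=> lf cf.
pose fL := GRing.isLinear.Build _ _ _ _ f lf.
pose L : {linear V -> R} := HB.pack f fL.
case=> [|k] /=; first by move=> x _; exact: cf.
have dL x : differentiable f x by exact: (@linear_differentiable _ _ _ L).
split=> // v; suff -> : (fun x => 'D_v f x) = cst (f v) by exact: Ck_cst.
apply/funext => x; rewrite deriveE //.
by rewrite (@diff_lin _ _ _ L).
Qed.

Lemma derive_mul f g x v : derivable f x v -> derivable g x v ->
  'D_v (fun z => f z * g z) x = f x * 'D_v g x + g x * 'D_v f x.
Proof. by move=> df dg; exact (deriveM df dg). Qed.

Lemma derive_add f g x v : derivable f x v -> derivable g x v ->
  'D_v (fun z => f z + g z) x = 'D_v f x + 'D_v g x.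
Proof. by move=> df dg; rewrite -[LHS]/('D_v (f + g) x) deriveD. Qed.

Lemma derive_sub f g x v : derivable f x v -> derivable g x v ->
  'D_v (fun z => f z - g z) x = 'D_v f x - 'D_v g x.
Proof. by move=> df dg; rewrite -[LHS]/('D_v (f - g) x) deriveB. Qed.

Lemma derive_bigsum n (f : 'I_n -> V -> R) x v : (forall i, derivable (f i) x v) ->
  'D_v (fun z => \sum_i f i z) x = \sum_i 'D_v (f i) x.
Proof.
move=> df; rewrite -(derive_sum df); congr ('D_v _ x).
by apply/funext => z; rewrite fct_sumE.
Qed.

Lemma derive_scale (c : R) f x v : derivable f x v ->
  'D_v (fun z => c * f z) x = c * 'D_v f x.
Proof. by move=> df; rewrite -[LHS]/('D_v (c *: f) x) deriveZ. Qed.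

(** The difference quotients of f at p + s u in the direction u are those of
    the restriction of f to the line through p. *)
Lemma is_derive_line f p u (s : R) : derivable f (p + s *: u) u ->
  is_derive s 1 (fun s => f (p + s *: u)) ('D_u f (p + s *: u)).
Proof.
have E : (fun h : R => h^-1 *: (((fun s => f (p + s *: u)) \o shift s) (h *: 1)
                  - f (p + s *: u))) =
    (fun h => h^-1 *: ((f \o shift (p + s *: u)) (h *: u) - f (p + s *: u))).
  apply/funext => h /=; congr (_ *: (f _ - _)).
  by rewrite [h%:A]mulr1 scalerDl addrCA.
by move=> df; split; rewrite /derivable /derive E.
Qed.

Lemma line_MVT f p u (h : R) : 0 < h ->
  (forall s, 0 <= s <= h -> derivable f (p + s *: u) u) ->
  exists2 s, 0 < s < h & f (p + h *: u) - f p = h * 'D_u f (p + s *: u).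
Proof.
move=> h0 df.
have isd s : 0 <= s <= h -> is_derive s (1 : R) (fun s => f (p + s *: u))
    ('D_u f (p + s *: u)).
  by move=> /df; exact: is_derive_line.
have [||s] := MVT (f := fun s => f (p + s *: u))
    (df := fun s => 'D_u f (p + s *: u)) h0.
- by move=> s; rewrite in_itv /= => /andP[s0 sh]; apply: isd; rewrite !ltW.
- by apply: derivable_within_continuous => s; rewrite in_itv /= => /isd[].
- by rewrite in_itv /= => s0h; rewrite scale0r addr0 subr0 mulrC; exists s.
Qed.

End SmoothFunctions.

Section SecondDerivatives.
Context {R : realType} {V : normedModType R}.
Implicit Types (U : set V) (f : V -> R) (x u v : V).

(** Two applications of the mean value theorem, first in the direction u to the
    difference of f in the direction v, then in the direction v. *)
Lemma second_difference f p u v (h : R) (U : set V) : open U -> smooth U f -> 0 < h ->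
  (forall s t, 0 <= s <= h -> 0 <= t <= h -> U (p + s *: u + t *: v)) ->
  exists s t, [/\ 0 <= s <= h, 0 <= t <= h &
   f (p + h *: u + h *: v) - f (p + h *: u) - (f (p + h *: v) - f p) =
   h * (h * 'D_v (fun x => 'D_u f x) (p + s *: u + t *: v))].
Proof.
move=> oU sf h0 pU; have hh : 0 <= h <= h by rewrite lexx ltW.
have oo : 0 <= (0 : R) <= h by rewrite lexx ltW.
have quot x y : (fun r : R => r^-1 *: (((fun z => f (z + x)) \o shift y) (r *: u) - f (y + x)))
    = (fun r => r^-1 *: ((f \o shift (y + x)) (r *: u) - f (y + x))).
  by apply/funext => r /=; rewrite addrA.
have shift_line x y : 'D_u (fun z => f (z + x)) y = 'D_u f (y + x).
  by rewrite /derive quot.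
have shift_dline x y : derivable f (y + x) u -> derivable (fun z => f (z + x)) y u.
  by rewrite /derivable quot.
have df s t : 0 <= s <= h -> 0 <= t <= h -> derivable f (p + s *: u + t *: v) u.
  by move=> sh th; apply: smooth_derivable sf _; exact: pU.
have [|s] := line_MVT (f := fun x => f (x + h *: v) - f x) (p := p) (u := u) h0.
  move=> s sh; apply: (@derivableB _ _ _ (fun x => f (x + h *: v)) f).
    exact: shift_dline (df _ _ sh hh).
  by have := df _ _ sh oo; rewrite scale0r addr0.
move=> /andP[s0 sh]; have sh' : 0 <= s <= h by rewrite !ltW.
rewrite derive_sub; first last.
- by have := df _ _ sh' oo; rewrite scale0r addr0.
- exact: shift_dline (df _ _ sh' hh).
rewrite shift_line => E.
have [|t] := line_MVT (f := fun x => 'D_u f x) (p := p + s *: u) (u := v) h0.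
  by move=> t th; apply: smooth_derivable (smooth_derive _ sf) _; exact: pU.
move=> /andP[t0 th] E'; exists s, t; split => //; first by rewrite !ltW.
by rewrite E -E'.
Qed.

Lemma common_modulus U x (a b : V -> R) (e : R) : open U -> U x ->
  {for x, continuous a} -> {for x, continuous b} -> 0 < e ->
  exists2 d, 0 < d & forall y, ball x d y ->
    [/\ U y, `|a x - a y| < e & `|b x - b y| < e].
Proof.
move=> oU Ux /cvgrPdist_lt ca /cvgrPdist_lt cb e0.
have : nbhs x (U `&` ([set y | `|a x - a y| < e] `&` [set y | `|b x - b y| < e])).
  apply: filterI; first exact: open_nbhs_nbhs.
  by apply: filterI; [exact: ca|exact: cb].
move=> /nbhs_ballP[d /= d0 dP].
by exists d => // y /dP[Uy [ay by']].
Qed.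

(** The second difference over a small parallelogram is symmetric in u and v,
    and each mixed derivative at x is its limit after division by h^2. *)
Theorem derive_comm U f x u v : open U -> smooth U f -> U x ->
  'D_u (fun y => 'D_v f y) x = 'D_v (fun y => 'D_u f y) x.
Proof.
move=> oU sf Ux; apply/eqP; rewrite -subr_eq0 -normr_le0; apply/ler_addgt0Pl => e e0; rewrite addr0.
have e20 : 0 < e / 2 by rewrite divr_gt0.
have cuv : {for x, continuous (fun y => 'D_u (fun y => 'D_v f y) y)}.
  exact: smooth_continuous (smooth_derive _ (smooth_derive _ sf)) Ux.
have cvu : {for x, continuous (fun y => 'D_v (fun y => 'D_u f y) y)}.
  exact: smooth_continuous (smooth_derive _ (smooth_derive _ sf)) Ux.
have [d d0 dP] := common_modulus oU Ux cuv cvu e20.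
(* The parallelogram of side h stays in the ball of radius d around x. *)
pose m := `|u| + `|v| + 1; have m0 : 0 < m by rewrite ltr_wpDl // addr_ge0.
pose h := d / 2 / m; have h0 : 0 < h by rewrite !divr_gt0.
have near_x s t : 0 <= s <= h -> 0 <= t <= h -> ball x d (x + s *: u + t *: v).
  move=> /andP[s0 sh] /andP[t0 th]; rewrite -ball_normE /=.
  rewrite -addrA opprD addNKr -normrN opprK.
  apply: (@le_lt_trans _ _ (h * m)).
    apply: le_trans (ler_normD _ _) _; rewrite !normrZ !ger0_norm // /m !mulrDr.
    by rewrite -[leLHS]addr0 mulr1 !lerD ?ler_wpM2r ?(ltW h0).
  by rewrite /h divfK ?gt_eqF // ltr_pdivrMr // ltr_pMr // ltr1n.
have [s [t [sh th E]]] := second_difference oU sf h0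
  (fun s t sh th => let: And3 H _ _ := dP _ (near_x s t sh th) in H).
have [t' [s' [th' sh' E']]] := @second_difference f x v u h U oU sf h0
  (fun t s th sh => let: And3 H _ _ := dP _ (near_x s t sh th) in
     eq_ind _ U H _ (addrAC _ _ _)).
have EE : 'D_v (fun x => 'D_u f x) (x + s *: u + t *: v) =
    'D_u (fun x => 'D_v f x) (x + t' *: v + s' *: u).
  apply: (mulfI (lt0r_neq0 h0)); apply: (mulfI (lt0r_neq0 h0)).
  apply: etrans (esym E) (etrans _ E'); rewrite (addrAC x (h *: v)).
  by ring.
have [_ _] := dP _ (near_x _ _ sh th); rewrite {}EE.
have [_ + _] := dP _ (near_x _ _ sh' th'); rewrite (addrAC x (s' *: u)).
move: ('D_u _ x) ('D_v _ x) ('D_u _ (x + t' *: v + s' *: u)) => a b c ac bc.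
have -> : a - b = (a - c) + (c - b) by rewrite addrA subrK.
by apply: le_trans (ler_normD _ _) _; rewrite (splitr e) lerD ?[`|c - b|]distrC ?ltW.
Qed.

End SecondDerivatives.

(** * The spray of a Finsler function in one chart *)

Section SmoothMatrices.
Context {R : realType} {V : normedModType R} {U : set V} (oU : open U).

Lemma smooth_det m (A : V -> 'M[R]_m) :
  (forall i j, smooth U (fun z => A z i j)) -> smooth U (fun z => \det (A z)).
Proof.
move=> sA; apply: smooth_sum => // s; apply: smooth_mul => //.
  exact: smooth_cst.
exact: smooth_prod.
Qed.

Lemma smooth_invmx m (A : V -> 'M[R]_m) :
  (forall i j, smooth U (fun z => A z i j)) -> (forall z, U z -> A z \in unitmx) ->
  forall i j, smooth U (fun z => invmx (A z) i j).
Proof.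
move=> sA uA i j.
have sdet : smooth U (fun z => (\det (A z))^-1).
  by apply: smooth_inv (smooth_det sA) => // z /uA; rewrite unitmxE unitfE.
have sadj : smooth U (fun z => \adj (A z) i j).
  apply: (@smooth_congr _ _ _ (fun z => cofactor (A z) j i)) => //.
    by move=> z _; rewrite mxE.
  apply: smooth_mul => //; first exact: smooth_cst.
  apply: smooth_det => k l; apply: (@smooth_congr _ _ _ (fun z => A z (lift j k) (lift i l))) => //.
  by move=> z _; rewrite !mxE.
apply: smooth_congr (oU) _ (smooth_mul oU sdet sadj) => z Uz.
by rewrite /invmx uA // [RHS]mxE.
Qed.

End SmoothMatrices.

Section Coordinates.
Context {R : realType} {n : nat}.
Local Notation V := ('rV[R]_n * 'rV[R]_n)%type.
Context {U : set V} (oU : open U).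
Implicit Types (f g : V -> R) (i j k l m : 'I_n) (z : V).

Lemma smooth_dx i f : smooth U f -> smooth U (dx i f).
Proof. exact: smooth_derive. Qed.

Lemma smooth_dy i f : smooth U f -> smooth U (dy i f).
Proof. exact: smooth_derive. Qed.

Lemma dy_dy i j f z : smooth U f -> U z -> dy i (dy j f) z = dy j (dy i f) z.
Proof. by move=> sf Uz; exact: derive_comm oU sf Uz. Qed.

Lemma dx_dy i j f z : smooth U f -> U z -> dx i (dy j f) z = dy j (dx i f) z.
Proof. by move=> sf Uz; exact: derive_comm oU sf Uz. Qed.

Lemma dx_congr i f g z : U z -> (forall w, U w -> f w = g w) -> dx i f z = dx i g z.
Proof. by move=> Uz fg; exact: derive_congr oU Uz fg. Qed.

Lemma dy_congr i f g z : U z -> (forall w, U w -> f w = g w) -> dy i f z = dy i g z.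
Proof. by move=> Uz fg; exact: derive_congr oU Uz fg. Qed.

Lemma dy_scale i (c : R) f z : U z -> smooth U f ->
  dy i (fun w => c * f w) z = c * dy i f z.
Proof. by move=> Uz sf; apply: derive_scale; exact: smooth_derivable sf Uz. Qed.

Lemma dx_scale i (c : R) f z : U z -> smooth U f ->
  dx i (fun w => c * f w) z = c * dx i f z.
Proof. by move=> Uz sf; apply: derive_scale; exact: smooth_derivable sf Uz. Qed.

Lemma dy_add i f g z : U z -> smooth U f -> smooth U g ->
  dy i (fun w => f w + g w) z = dy i f z + dy i g z.
Proof. by move=> Uz sf sg; apply: derive_add; exact: smooth_derivable Uz. Qed.

Lemma dy_sub i f g z : U z -> smooth U f -> smooth U g ->
  dy i (fun w => f w - g w) z = dy i f z - dy i g z.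
Proof. by move=> Uz sf sg; apply: derive_sub; exact: smooth_derivable Uz. Qed.

Lemma dy0 i z : dy i (fun=> 0) z = 0 :> R.
Proof. exact: derive_cst. Qed.

Lemma dx0 i z : dx i (fun=> 0) z = 0 :> R.
Proof. exact: derive_cst. Qed.

Let ycoord_linear i : linear (@ycoord R n i).
Proof. by move=> a [x y] [x' y']; rewrite /ycoord /= !mxE. Qed.

Let ycoord_continuous i : continuous (@ycoord R n i).
Proof.
move=> [x y]; apply: (@continuous_comp _ _ _ snd (fun v : 'rV[R]_n => v 0 i)).
  exact: cvg_snd.
exact: coord_continuous.
Qed.

Lemma smooth_ycoord i : smooth U (@ycoord R n i).
Proof. exact: smooth_linear (ycoord_linear i) (@ycoord_continuous i). Qed.

Lemma derive_ycoord i z v : 'D_v (@ycoord R n i) z = v.2 0 i.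
Proof.
pose fL := GRing.isLinear.Build _ _ _ _ _ (ycoord_linear i).
pose L : {linear V -> R} := HB.pack (@ycoord R n i) fL.
have dL : differentiable (@ycoord R n i) z.
  exact: (@linear_differentiable _ _ _ L z (@ycoord_continuous i)).
by rewrite deriveE // (@diff_lin _ _ _ L _ (@ycoord_continuous i)).
Qed.

Lemma derive_contract (f g : 'I_n -> V -> R) z v : U z ->
  (forall i, smooth U (f i)) -> (forall i, smooth U (g i)) ->
  'D_v (fun w => \sum_i f i w * g i w) z =
  \sum_i f i z * 'D_v (g i) z + \sum_i g i z * 'D_v (f i) z.
Proof.
move=> Uz sf sg; rewrite derive_bigsum; last first.
  by move=> i; apply: smooth_derivable (smooth_mul oU (sf i) (sg i)) Uz.
rewrite -big_split; apply: eq_bigr => i _.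
by rewrite derive_mul //; apply: smooth_derivable Uz.
Qed.

Lemma dy_contract j (f g : 'I_n -> V -> R) z : U z ->
  (forall i, smooth U (f i)) -> (forall i, smooth U (g i)) ->
  dy j (fun w => \sum_i f i w * g i w) z =
  \sum_i f i z * dy j (g i) z + \sum_i g i z * dy j (f i) z.
Proof. exact: derive_contract. Qed.

Lemma dy_ycontract j (f : 'I_n -> V -> R) z : U z -> (forall i, smooth U (f i)) ->
  dy j (fun w => \sum_i ycoord i w * f i w) z = \sum_i ycoord i z * dy j (f i) z + f j z.
Proof.
move=> Uz sf; rewrite dy_contract //; last exact: smooth_ycoord.
congr (_ + _); rewrite (bigD1 j) //= big1 ?addr0 => [|i ij].
  by rewrite /dy derive_ycoord /= mxE !eqxx mulr1.
by rewrite /dy derive_ycoord /= mxE (negbTE ij) andbF mulr0.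
Qed.

Lemma dx_ycontract j (f : 'I_n -> V -> R) z : U z -> (forall i, smooth U (f i)) ->
  dx j (fun w => \sum_i ycoord i w * f i w) z = \sum_i ycoord i z * dx j (f i) z.
Proof.
move=> Uz sf; rewrite /dx derive_contract //; last exact: smooth_ycoord.
rewrite [X in _ + X]big1 ?addr0 // => i _.
by rewrite derive_ycoord /= mxE mulr0.
Qed.

Lemma euler_dx l f z : U z -> smooth U f ->
  \sum_j ycoord j z * dy j (dx l f) z = dx l (fun w => \sum_j ycoord j w * dy j f w) z.
Proof.
move=> Uz sf; rewrite (dx_ycontract l (f := fun j => dy j f) Uz); last by move=> j; exact: smooth_dy.
by apply: eq_bigr => j _; rewrite dx_dy.
Qed.

Lemma euler_dy l f z : U z -> smooth U f -> \sum_j ycoord j z * dy j (dy l f) z =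
  dy l (fun w => \sum_j ycoord j w * dy j f w) z - dy l f z.
Proof.
move=> Uz sf; rewrite (dy_ycontract l (f := fun j => dy j f) Uz); last by move=> j; exact: smooth_dy.
by rewrite addrK; apply: eq_bigr => j _; rewrite dy_dy.
Qed.

End Coordinates.

Lemma mul_invmx_sum (K : fieldType) n (A : 'M[K]_n) (w : 'I_n -> K) l :
  A \in unitmx -> \sum_i A l i * (\sum_m invmx A i m * w m) = w l.
Proof.
move=> uA; have := congr1 (fun B : 'cV_n => B l 0) (mulKVmx uA (\col_m w m)).
rewrite !mxE => <-; apply: eq_bigr => i _; rewrite mxE; congr (_ * _).
by apply: eq_bigr => m _; rewrite mxE.
Qed.

(** Smoothness of an expression built from partial derivatives, coordinates and
    ring operations. The shape is matched syntactically, since unification with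
    the closure lemmas would unfold derivatives into limits. *)
Ltac sm := lazymatch goal with
  | |- forall _, _ => move=> ?; sm
  | |- smooth _ (dx _ _) => apply: smooth_dx; sm
  | |- smooth _ (dy _ _) => apply: smooth_dy; sm
  | |- smooth _ (ycoord _) => exact: smooth_ycoord
  | |- smooth _ (spray _ _) => match goal with H : _ |- _ => solve [simple apply H] end
  | |- @smooth _ _ _ _ ?f =>
    let b := eval cbv beta in (f 0) in
    lazymatch b with
    | dx _ _ _ => apply: smooth_dx; sm
    | dy _ _ _ => apply: smooth_dy; sm
    | ycoord _ _ => exact: smooth_ycoord
    | _ * _ => apply: smooth_mul; [assumption|sm|sm]
    | _ - _ => apply: smooth_sub; [assumption|sm|sm]
    | _ + _ => apply: smooth_add; [assumption|sm|sm]
    | @bigop.body _ _ _ _ _ => apply: smooth_sum; [assumption|sm]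
    | _ => first [match goal with H : _ |- _ => solve [simple apply H] end | exact: smooth_cst]
    end
  end.

Section LocalFinsler.
Context {R : realType} {n : nat}.
Local Notation V := ('rV[R]_n * 'rV[R]_n)%type.
Context {U : set V} (oU : open U).
Variable F : V -> R.
Local Notation E := (F2 F).
Local Notation G := (spray F).
Local Notation y := (@ycoord R n).
Implicit Types (i j k l m p q : 'I_n) (z : V).

Hypothesis sE : smooth U E.
Hypothesis metric_unit : forall z, U z -> (\matrix_(i < n, j < n) gmetric F i j z) \in unitmx.
Hypothesis eulerE : forall z, U z -> \sum_i y i z * dy i E z = 2 * E z.

(* Unification must not unfold the partial derivatives into limits. *)
Local Opaque dx dy.

Lemma smooth_gmetric i j : smooth U (gmetric F i j).
Proof. by apply: (smooth_mul oU); sm. Qed.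

Lemma smooth_ginv i j : smooth U (ginv F i j).
Proof.
apply: (smooth_invmx oU (A := fun z => \matrix_(i < n, j < n) gmetric F i j z)) => //.
move=> k l; apply: smooth_congr (oU) _ (smooth_gmetric k l) => z _.
by rewrite mxE.
Qed.

Lemma smooth_spray i : smooth U (G i).
Proof.
apply: (smooth_mul oU); first exact: smooth_cst.
apply: (smooth_sum _ _ oU) => l; apply: (smooth_mul oU); first exact: smooth_ginv.
by sm.
Qed.

Lemma smooth_cartan i j k : smooth U (cartan F i j k).
Proof. by apply: (smooth_mul oU); [exact: smooth_cst|exact/smooth_dy/smooth_gmetric]. Qed.

Lemma dydyE i j z : dy i (dy j E) z = 2 * gmetric F i j z.
Proof. by rewrite /gmetric mulrA divff ?mul1r. Qed.

Lemma cartanE i j k z : U z -> cartan F i j k z = 4^-1 * dy k (dy i (dy j E)) z.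
Proof.
move=> Uz; rewrite /cartan /gmetric (dy_scale _ _ Uz) //; last by sm.
by rewrite mulrA; congr (_ * _); field.
Qed.

(** The defining relation of the spray, with the inverse metric moved to the
    other side; it says that the geodesics are the extremals of E. *)
Lemma spray_metric l z : U z -> \sum_i dy l (dy i E) z * G i z =
  2^-1 * (\sum_k y k z * dx k (dy l E) z - dx l E z).
Proof.
move=> Uz.
pose w l := \sum_k dx k (dy l E) z * y k z - dx l E z.
have := mul_invmx_sum w l (metric_unit Uz).
have -> : \sum_k y k z * dx k (dy l E) z - dx l E z = w l.
  by rewrite /w; congr (_ - _); apply: eq_bigr => k _; rewrite mulrC.
move=> <-; rewrite mulr_sumr; apply: eq_bigr => i _.
rewrite dydyE mxE /spray; set S := (X in 4^-1 * X); set S' := \sum_m _.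
by rewrite -[S']/S; field.
Qed.

Lemma euler_dyE j z : U z -> \sum_i y i z * dy i (dy j E) z = dy j E z.
Proof.
move=> Uz; rewrite (euler_dy oU) // (dy_congr oU j Uz eulerE) (dy_scale _ _ Uz) //.
by rewrite mulr_natl mulr2n addrK.
Qed.

Lemma euler_dydyE j k z : U z -> \sum_i y i z * dy i (dy j (dy k E)) z = 0.
Proof.
move=> Uz; rewrite (euler_dy oU) //; last by sm.
by rewrite (dy_congr oU j Uz (@euler_dyE k)) subrr.
Qed.

(** The spray is 2-homogeneous: apply the Euler operator to its defining
    relation, where the metric is 0-homogeneous. *)
Lemma euler_spray i z : U z -> \sum_j y j z * dy j (G i) z = 2 * G i z.
Proof.
move=> Uz; have sG := smooth_spray.
pose d m := \sum_j y j z * dy j (G m) z - 2 * G m z.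
(* The metric is invertible: it suffices that it annihilates the defect d. *)
suff md0 l : \sum_m dy l (dy m E) z * d m = 0.
  apply/eqP; rewrite -subr_eq0 -/(d i); apply/eqP.
  have : (\matrix_(i < n, j < n) gmetric F i j z) *m (\col_m d m) = 0.
    apply/matrixP => l c; rewrite !mxE; transitivity (2^-1 * \sum_m dy l (dy m E) z * d m).
      by rewrite mulr_sumr; apply: eq_bigr => m _; rewrite !mxE mulrA.
    by rewrite md0 mulr0.
  move/(congr1 (mulmx (invmx (\matrix_(i < n, j < n) gmetric F i j z)))).
  rewrite mulKmx ?metric_unit // mulmx0 => /matrixP/(_ i 0).
  by rewrite !mxE.
have dG : \sum_m dy l (dy m E) z * \sum_j y j z * dy j (G m) z =
    \sum_j y j z * dy j (fun w => \sum_m dy l (dy m E) w * G m w) z.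
  under [RHS]eq_bigr => j _.
    rewrite (dy_contract oU) //; last by move=> m; sm.
    rewrite mulrDr; over.
  rewrite big_split /= [X in _ + X](_ : _ = 0) ?addr0.
    under eq_bigr do rewrite mulr_sumr.
    rewrite exchange_big; apply: eq_bigr => j _ /=; rewrite mulr_sumr.
    by apply: eq_bigr => m _; rewrite mulrCA.
  under eq_bigr do rewrite mulr_sumr.
  rewrite exchange_big big1 //= => m _.
  under eq_bigr do rewrite mulrCA.
  by rewrite -mulr_sumr euler_dydyE // mulr0.
under eq_bigr do rewrite mulrBr.
rewrite sumrB dG.
under [X in _ - X]eq_bigr do rewrite mulrCA.
rewrite -mulr_sumr spray_metric //.
have -> : \sum_j y j z * dy j (fun w => \sum_m dy l (dy m E) w * G m w) z =
    \sum_j y j z * dy j (fun w => 2^-1 * (\sum_k y k w * dx k (dy l E) w - dx l E w)) z.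
  apply: eq_bigr => j _; congr (_ * _); apply: (dy_congr oU) => // w Uw.
  exact: spray_metric.
have dR j : dy j (fun w => 2^-1 * (\sum_k y k w * dx k (dy l E) w - dx l E w)) z =
    2^-1 * (\sum_k y k z * dy j (dx k (dy l E)) z + dx j (dy l E) z - dy j (dx l E) z).
  rewrite (dy_scale _ _ Uz); last by sm.
  rewrite (dy_sub _ Uz); [|by sm|by sm].
  by rewrite (dy_ycontract oU) //; sm.
under eq_bigr => j _ do rewrite dR mulrCA mulrBr (mulrDr (y j z)).
rewrite -mulr_sumr sumrB big_split /=.
transitivity (2^-1 * (\sum_k y k z * dx k (dy l E) z + \sum_k y k z * dx k (dy l E) z
    - 2 * dx l E z) - 2 * (2^-1 * (\sum_k y k z * dx k (dy l E) z - dx l E z))); last by field.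
congr (2^-1 * (_ + _ - _) - _).
  under eq_bigr do rewrite mulr_sumr.
  rewrite exchange_big; apply: eq_bigr => k _ /=.
  under eq_bigr do rewrite mulrCA.
  rewrite -mulr_sumr (euler_dx oU k Uz (smooth_dy l sE)).
  by rewrite (dx_congr oU k Uz (@euler_dyE l)).
by rewrite (euler_dx oU l Uz sE) (dx_congr oU l Uz eulerE) (dx_scale l 2 Uz sE).
Qed.

Lemma euler_dspray i k z : U z -> \sum_j y j z * dy j (dy k (G i)) z = dy k (G i) z.
Proof.
move=> Uz; rewrite (euler_dy oU) //; last exact: smooth_spray.
rewrite (dy_congr oU k Uz (@euler_spray i)) (dy_scale _ _ Uz); last exact: smooth_spray.
by rewrite mulr_natl mulr2n addrK.
Qed.

(** E is constant along the geodesics. *)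
Lemma spray_E z : U z -> \sum_k y k z * dx k E z = 2 * \sum_i G i z * dy i E z.
Proof.
move=> Uz.
have yg : \sum_l y l z * (\sum_i dy l (dy i E) z * G i z) = \sum_i G i z * dy i E z.
  under eq_bigr do rewrite mulr_sumr.
  rewrite exchange_big; apply: eq_bigr => i _ /=.
  by rewrite -euler_dyE // mulr_sumr; apply: eq_bigr => l _; rewrite mulrA mulrC.
apply: etrans (congr1 ( *%R 2) yg).
under [in RHS]eq_bigr do rewrite spray_metric // mulrCA mulrBr.
rewrite -mulr_sumr sumrB.
have -> : \sum_l y l z * \sum_k y k z * dx k (dy l E) z = 2 * \sum_k y k z * dx k E z.
  under eq_bigr do rewrite mulr_sumr.
  rewrite exchange_big mulr_sumr; apply: eq_bigr => k _ /=.
  rewrite mulrCA -(dx_scale k 2 Uz sE) -(dx_congr oU k Uz eulerE).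
  rewrite (dx_ycontract oU k (f := fun l => dy l E) Uz); last by move=> l; sm.
  by rewrite mulr_sumr; apply: eq_bigr => l _; rewrite mulrCA.
by field.
Qed.

(** The derivative of E along a coordinate x is its derivative along the
    vertical vector that corrects that coordinate to a horizontal one. *)
Lemma dxE m z : U z -> dx m E z = \sum_i dy m (G i) z * dy i E z.
Proof.
move=> Uz; have sG := smooth_spray.
have := dy_congr oU m Uz spray_E.
rewrite (dy_ycontract oU m (f := fun k => dx k E) Uz); last by move=> k; sm.
rewrite (dy_scale _ _ Uz); last by sm.
rewrite (dy_contract oU m (f := G) (g := fun i => dy i E) Uz) //; last by move=> k; sm.
(* The sums enter the linear arithmetic as abstract numbers. *)
have alg (a b c s a' c' s' : R) : a + b = 2 * (s + c) -> s' = 2^-1 * (a' - b) ->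
  a = a' -> s = s' -> c = c' -> b = c'.
  by move=> e1 e2 ea es ec; lra.
move=> e1; apply: alg e1 (spray_metric m Uz) _ _ _; apply: eq_bigr => i _.
- by rewrite (dx_dy oU).
- exact: mulrC.
- exact: mulrC.
Qed.

(** The spray, as a vector field on the slit tangent bundle; along a geodesic
    it is the derivative with respect to time. *)
Definition spray_field (f : V -> R) z : R :=
  \sum_k y k z * dx k f z - 2 * \sum_i G i z * dy i f z.
Local Notation X := spray_field.

Lemma spray_field_congr f g z : U z -> (forall w, U w -> f w = g w) -> X f z = X g z.
Proof.
move=> Uz fg; rewrite /spray_field; congr (_ - 2 * _); apply: eq_bigr => k _.
  by rewrite (dx_congr oU k Uz fg).
by rewrite (dy_congr oU k Uz fg).
Qed.

Lemma spray_field_scale (c : R) f z : U z -> smooth U f ->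
  X (fun w => c * f w) z = c * X f z.
Proof.
move=> Uz sf; have alg (a s a' s' : R) : a = c * a' -> s = c * s' ->
  a - 2 * s = c * (a' - 2 * s') by move=> -> ->; ring.
apply: alg; rewrite mulr_sumr; apply: eq_bigr => k _.
  by rewrite (dx_scale _ _ Uz) // mulrCA.
by rewrite (dy_scale _ _ Uz) // mulrCA.
Qed.

Lemma dy_spray_field p f z : U z -> smooth U f ->
  dy p (X f) z = X (dy p f) z + dx p f z - 2 * \sum_i dy p (G i) z * dy i f z.
Proof.
move=> Uz sf; have sG := smooth_spray.
rewrite /spray_field (dy_sub _ Uz); first last.
- by sm.
- by sm.
rewrite (dy_ycontract oU p (f := fun k => dx k f) Uz); last by move=> k; sm.
rewrite (dy_scale _ _ Uz); last by sm.
rewrite (dy_contract oU p (f := G) (g := fun i => dy i f) Uz) //; last by move=> k; sm.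
have alg (a b c s a' c' s' : R) : a = a' -> s = s' -> c = c' ->
  a + b - 2 * (s + c) = a' - 2 * s' + b - 2 * c'.
  by move=> -> -> ->; ring.
apply: alg; apply: eq_bigr => i _; last exact: mulrC.
  by rewrite (dx_dy oU).
by rewrite (dy_dy oU).
Qed.

Lemma spray_field_dyE m z : U z -> X (dy m E) z = \sum_i dy m (G i) z * dy i E z.
Proof.
move=> Uz; rewrite -dxE // /spray_field.
have alg (a b s s' : R) : s' = 2^-1 * (a - b) -> s = s' -> a - 2 * s = b.
  by move=> e1 e2; lra.
apply: alg (spray_metric m Uz) _; apply: eq_bigr => i _.
by rewrite mulrC (dy_dy oU).
Qed.

(** Vertical derivative of the preceding identity. The second derivatives of the
    spray cancel by symmetry: the metric is parallel along geodesics. *)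
Lemma spray_field_metric p m z : U z -> X (dy p (dy m E)) z =
  \sum_i dy m (G i) z * dy i (dy p E) z + \sum_i dy p (G i) z * dy i (dy m E) z.
Proof.
move=> Uz; have sG := smooth_spray.
have alg (l x d s a b a' b' t u : R) : l = x + d - 2 * s -> l = a + b -> d = a' + b' ->
  b = b' -> a = t -> s = u -> a' = u -> x = t + u.
  by move=> *; lra.
have h1 := dy_spray_field p Uz (smooth_dy m sE).
have h2 := dy_congr oU p Uz (@spray_field_dyE m).
rewrite (dy_contract oU p (f := fun i => dy m (G i)) (g := fun i => dy i E) Uz) in h2;
  [|by move=> k; apply: smooth_dy|by move=> k; sm].
have h3 : dx p (dy m E) z = dy m (dx p E) z by rewrite (dx_dy oU).
rewrite (dy_congr oU m Uz (@dxE p)) in h3.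
rewrite (dy_contract oU m (f := fun i => dy p (G i)) (g := fun i => dy i E) Uz) in h3;
  [|by move=> k; apply: smooth_dy|by move=> k; sm].
apply: alg h1 h2 h3 _ _ _ _; apply: eq_bigr => i _.
- by rewrite (dy_dy oU p m).
- by rewrite (dy_dy oU p i).
- by [].
- by rewrite (dy_dy oU m i).
Qed.

(** Differentiating once more, the third derivatives of the spray survive: the
    Cartan torsion fails to be parallel along geodesics by the Berwald
    curvature contracted with the covector dE. *)
Lemma spray_field_dyyyE p m q z : U z -> X (dy q (dy p (dy m E))) z =
  \sum_i dy q (G i) z * dy i (dy p (dy m E)) z
  + \sum_i dy m (G i) z * dy i (dy q (dy p E)) z
  + \sum_i dy p (G i) z * dy i (dy q (dy m E)) z
  - \sum_i dy i E z * berwald F i p m q z.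
Proof.
move=> Uz; have sG := smooth_spray.
have sN i j : smooth U (dy j (G i)) by exact: smooth_dy.
have alg (l x d s a1 a2 a3 a4 b1 b2 b3 b4 t u : R) :
  l = x + d - 2 * s -> l = (a1 + a2) + (a3 + a4) -> d = (b1 + b2) + (b3 + b4) ->
  s = b1 -> a2 = b4 -> a4 = b2 -> a1 = t -> a3 = u -> x = s + t + u - b3.
  by move=> *; lra.
have h1 := dy_spray_field q Uz (smooth_dy p (smooth_dy m sE)).
have sNE i j : smooth U (fun w => \sum_s dy i (G s) w * dy s (dy j E) w) by sm.
have sNE' i j : smooth U (fun w => \sum_s dy i (G s) w * dy j (dy s E) w) by sm.
have sEN i j : smooth U (fun w => \sum_s dy s E w * dy i (dy j (G s)) w) by sm.
have dNE i j : dy q (fun w => \sum_s dy i (G s) w * dy s (dy j E) w) z =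
    \sum_s dy i (G s) z * dy q (dy s (dy j E)) z + \sum_s dy s (dy j E) z * dy q (dy i (G s)) z.
  by apply: (dy_contract oU) => // s; sm.
have h2 := etrans (dy_congr oU q Uz (@spray_field_metric p m))
  (etrans (dy_add q Uz (sNE m p) (sNE p m)) (congr2 +%R (dNE m p) (dNE p m))).
have h3 := etrans (dx_dy oU q p (smooth_dy m sE) Uz)
  (dy_congr oU p Uz (fun w Uw => dx_dy oU q m sE Uw)).
have h4 w : U w -> dy m (dx q E) w =
    \sum_i dy q (G i) w * dy m (dy i E) w + \sum_i dy i E w * dy m (dy q (G i)) w :=
  fun Uw => etrans (dy_congr oU m Uw (@dxE q))
    (dy_contract oU m Uw (fun s => sN s q) (fun s => smooth_dy s sE)).
have h5 := dy_contract oU p Uz (fun s => sN s q) (fun s => smooth_dy m (smooth_dy s sE)).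
have h6 := dy_contract oU p Uz (fun s => smooth_dy s sE) (fun s => smooth_dy m (sN s q)).
have h7 := etrans h3 (etrans (dy_congr oU p Uz h4)
  (etrans (dy_add p Uz (sNE' q m) (sEN m q)) (congr2 +%R h5 h6))).
apply: alg h1 h2 h7 _ _ _ _ _; apply: eq_bigr => i _.
- refine (congr1 ( *%R _) (etrans (dy_dy oU i p (smooth_dy m sE) Uz) _)).
  exact: (dy_congr oU p Uz (fun w => dy_dy oU i m sE)).
- refine (etrans (mulrC _ _) _).
  exact (congr2 *%R (dy_dy oU q m (sG i) Uz) (dy_dy oU i p sE Uz)).
- exact (congr2 *%R (dy_dy oU i m sE Uz) (dy_dy oU q p (sG i) Uz)).
- exact (congr1 ( *%R _) (dy_dy oU q i (smooth_dy p sE) Uz)).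
- exact (congr1 ( *%R _) (dy_dy oU q i (smooth_dy m sE) Uz)).
Qed.

End LocalFinsler.

(** * The Landsberg curvature in one chart *)

Section LandsbergCurvature.
Context {R : realType} {n : nat}.
Local Notation V := ('rV[R]_n * 'rV[R]_n)%type.
Context {U : set V} (oU : open U).
Variable F : V -> R.
Local Notation E := (F2 F).
Local Notation G := (spray F).
Local Notation y := (@ycoord R n).
Implicit Types (i j k l m p q : 'I_n) (z : V).

Hypothesis sE : smooth U E.
Hypothesis metric_unit : forall z, U z -> (\matrix_(i < n, j < n) gmetric F i j z) \in unitmx.
Hypothesis eulerE : forall z, U z -> \sum_i y i z * dy i E z = 2 * E z.

Local Opaque dx dy.

Let sG i : smooth U (G i). Proof. exact: smooth_spray. Qed.

Lemma hdelta_spray f z : U z -> \sum_s hdelta F s f z * y s z = spray_field F f z.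
Proof.
move=> Uz; under eq_bigr do rewrite mulrBl.
rewrite sumrB /spray_field; apply: f_equal2; first by apply: eq_bigr => s _; exact: mulrC.
apply: f_equal; under eq_bigr do rewrite mulr_suml.
rewrite exchange_big mulr_sumr; apply: eq_bigr => m _ /=.
rewrite mulrA -(euler_spray oU sE metric_unit eulerE m Uz) mulr_suml.
by apply: eq_bigr => s _; rewrite mulrC mulrA.
Qed.

(** The connection coefficients are 0-homogeneous, so that contracting a
    horizontal derivative with the position vector gives the derivative along
    the spray corrected by the first derivatives of the spray. *)
Lemma connection_spray (T : 'I_n -> R) i z : U z ->
  \sum_s (\sum_m T m * connection F m i s z) * y s z = \sum_m T m * dy i (G m) z.
Proof.
move=> Uz; under eq_bigr do rewrite mulr_suml.
rewrite exchange_big; apply: eq_bigr => m _ /=.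
rewrite -(euler_dspray oU sE metric_unit eulerE m i Uz) mulr_sumr.
apply: eq_bigr => s _; rewrite -mulrA; apply: f_equal; rewrite mulrC; apply: f_equal.
exact: (dy_dy oU).
Qed.

Lemma hcov3_spray (T : 'I_n -> 'I_n -> 'I_n -> V -> R) i j k z : U z ->
  \sum_s hcov3 F T i j k s z * y s z = spray_field F (T i j k) z
    - \sum_m T m j k z * dy i (G m) z - \sum_m T i m k z * dy j (G m) z
    - \sum_m T i j m z * dy k (G m) z.
Proof.
move=> Uz; under eq_bigr do rewrite /hcov3 3!mulrBl.
have alg (a b c d a' b' c' d' : R) : a = a' -> b = b' -> c = c' -> d = d' ->
  a - b - c - d = a' - b' - c' - d' by move=> -> -> -> ->.
rewrite 3!sumrB; apply: alg; first exact: hdelta_spray.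
- exact: (connection_spray (fun m => T m j k z)).
- exact: (connection_spray (fun m => T i m k z)).
- exact: (connection_spray (fun m => T i j m z)).
Qed.

Lemma cartan_transport j k l z : U z -> spray_field F (cartan F j k l) z =
  landsberg F j k l z + \sum_m cartan F m k l z * dy j (G m) z
  + \sum_m cartan F j m l z * dy k (G m) z + \sum_m cartan F j k m z * dy l (G m) z.
Proof.
move=> Uz; have alg (s x a b c : R) : s = x - a - b - c -> x = s + a + b + c.
  by move=> ->; ring.
exact: alg (hcov3_spray (cartan F) j k l Uz).
Qed.

(** The classical identity L_jkl = - y_i B^i_jkl / 2, where dE/dy^i = 2 y_i. *)
Lemma landsbergE j k l z : U z ->
  landsberg F j k l z = - 4^-1 * \sum_i dy i E z * berwald F i j k l z.
Proof.
move=> Uz; apply: etrans (hcov3_spray (cartan F) j k l Uz) _.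
have alg (x x' a b c a' b' c' d : R) : x' = a' + b' + c' - d -> x = 4^-1 * x' ->
  a = 4^-1 * c' -> b = 4^-1 * b' -> c = 4^-1 * a' -> x - a - b - c = - 4^-1 * d.
  by move=> *; lra.
apply: alg (spray_field_dyyyE oU sE metric_unit eulerE j k l Uz) _ _ _ _.
- apply: etrans (spray_field_congr oU F Uz (fun w => @cartanE _ _ _ F sE j k l w)) _.
  exact: (spray_field_scale F 4^-1 Uz (smooth_dy l (smooth_dy j (smooth_dy k sE)))).
- rewrite mulr_sumr; apply: eq_bigr => i _; rewrite (cartanE sE) // -mulrA.
  apply: f_equal; rewrite mulrC; apply: f_equal.
  exact: (dy_dy oU l i (smooth_dy k sE) Uz).
- rewrite mulr_sumr; apply: eq_bigr => i _; rewrite (cartanE sE) // -mulrA.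
  apply: f_equal; rewrite mulrC; apply: f_equal.
  refine (etrans _ (dy_dy oU l i (smooth_dy j sE) Uz)).
  exact: (dy_congr oU l Uz (fun w => dy_dy oU j i sE)).
- rewrite mulr_sumr; apply: eq_bigr => i _; rewrite (cartanE sE) // -mulrA.
  by apply: f_equal; rewrite mulrC.
Qed.

Lemma smooth_landsberg j k l : smooth U (landsberg F j k l).
Proof.
apply: (@smooth_congr _ _ _ (fun z => - 4^-1 * \sum_i dy i E z * berwald F i j k l z)) => //.
  by move=> z Uz; rewrite landsbergE.
by rewrite /berwald; sm.
Qed.

Lemma cartan_y j k z : U z -> \sum_l y l z * cartan F j k l z = 0.
Proof.
move=> Uz; refine (etrans _ (etrans
  (congr1 ( *%R 4^-1) (euler_dydyE oU sE eulerE j k Uz)) (mulr0 _))).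
by rewrite mulr_sumr; apply: eq_bigr => l _; rewrite (cartanE sE) // mulrCA.
Qed.

Lemma ylowE i z : U z -> ylow F i z = 2^-1 * dy i E z.
Proof.
move=> Uz; rewrite -(euler_dyE oU sE eulerE i Uz) mulr_sumr; apply: eq_bigr => j _.
by rewrite /gmetric -mulrA; apply: f_equal; rewrite mulrC (dy_dy oU i j sE Uz).
Qed.

Hypothesis F_neq0 : forall z, U z -> F z != 0.

Lemma dE_hmix j z : U z -> \sum_i dy i E z * hmix F i j z = 0.
Proof.
have alg (e v : 'I_n -> R) (c l : R) : \sum_i e i * ((i == j)%:R - c * v i * l) =
    e j - c * l * \sum_i v i * e i.
  under eq_bigr do rewrite mulrBr.
  rewrite sumrB (bigD1 j) //= eqxx mulr1 big1 ?addr0 => [|i /negbTE ->]; last exact: mulr0.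
  by rewrite mulr_sumr; congr (_ - _); apply: eq_bigr => i _; ring.
move=> Uz; rewrite /hmix (alg (fun i => dy i E z)) eulerE // ylowE // /F2.
by field; exact: F_neq0.
Qed.

Lemma dE_ell z : U z -> \sum_i dy i E z * ell F i z = 2 * F z.
Proof.
have alg (e v : 'I_n -> R) (c : R) : \sum_i e i * (v i / c) = c^-1 * \sum_i v i * e i.
  by rewrite mulr_sumr; apply: eq_bigr => i _; ring.
move=> Uz; rewrite /ell (alg (fun i => dy i E z)) eulerE // /F2.
by field; exact: F_neq0.
Qed.

Variables mu lambda : V -> R.
Hypothesis isotropic : forall z, U z -> forall i j k l, berwald F i j k l z =
  mu z * cartan F j k l z * ell F i z +
  lambda z * (hmix F i j z * hlow F k l z + hmix F i k z * hlow F j l z +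
              hmix F i l z * hlow F j k z).

(** The contraction with dE kills the terms containing h^i_j, by [dE_hmix]. *)
Lemma landsberg_isotropic j k l z : U z ->
  landsberg F j k l z = - (2^-1 * mu z * F z) * cartan F j k l z.
Proof.
have alg (e b v h1 h2 h3 : 'I_n -> R) (m c t r k1 k2 k3 : R) :
    (forall i, b i = m * c * v i + r * (h1 i * k1 + h2 i * k2 + h3 i * k3)) ->
    \sum_i e i * v i = t -> \sum_i e i * h1 i = 0 -> \sum_i e i * h2 i = 0 ->
    \sum_i e i * h3 i = 0 -> \sum_i e i * b i = m * c * t.
  move=> bE e0 e1 e2 e3.
  transitivity (m * c * \sum_i e i * v i + r * k1 * \sum_i e i * h1 i
    + r * k2 * \sum_i e i * h2 i + r * k3 * \sum_i e i * h3 i).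
    rewrite !mulr_sumr -!big_split /=; apply: eq_bigr => i _.
    by rewrite bE; ring.
  by rewrite e0 e1 e2 e3 !mulr0 !addr0.
move=> Uz; rewrite landsbergE // (alg _ _ _ _ _ _ _ _ _ _ _ _ _
  (fun i => isotropic Uz i j k l) (dE_ell Uz) (dE_hmix j Uz) (dE_hmix k Uz) (dE_hmix l Uz)).
by field.
Qed.

Lemma landsberg_y i j z : U z -> \sum_l y l z * landsberg F i j l z = 0.
Proof.
move=> Uz; refine (etrans _ (etrans
  (congr1 ( *%R (- (2^-1 * mu z * F z))) (cartan_y i j Uz)) (mulr0 _))).
rewrite mulr_sumr; apply: eq_bigr => l _; by rewrite landsberg_isotropic // mulrCA.
Qed.

(** The term where the position vector is differentiated cancels against the
    contraction of the connection with the third slot. *)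
Lemma landsberg_hcov_y i j k z : U z ->
  \sum_l hcov3 F (landsberg F) i j l k z * y l z = 0.
Proof.
move=> Uz.
have alg (s a b c d : R) : a = s -> b = 0 -> c = 0 -> d = s -> a - b - c - d = 0.
  by move=> *; lra.
under eq_bigr do rewrite /hcov3 3!mulrBl.
rewrite 3!sumrB; apply: (alg (\sum_m landsberg F i j m z * dy k (G m) z)).
- have dxL : \sum_l y l z * dx k (landsberg F i j l) z = 0.
    refine (etrans (esym (dx_ycontract oU k Uz (smooth_landsberg i j))) _).
    exact: etrans (dx_congr oU k Uz (landsberg_y i j)) (dx0 k z).
  have dyL m : \sum_l y l z * dy m (landsberg F i j l) z = - landsberg F i j m z.
    apply/eqP; rewrite -subr_eq0 opprK; apply/eqP.
    refine (etrans (esym (dy_ycontract oU m Uz (smooth_landsberg i j))) _).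
    exact: etrans (dy_congr oU m Uz (landsberg_y i j)) (dy0 m z).
  have alg2 (a b c : R) : a = 0 -> b = - c -> a - b = c by move=> -> ->; rewrite sub0r opprK.
  under eq_bigr do rewrite mulrBl; rewrite sumrB; apply: alg2.
    by rewrite -[RHS]dxL; apply: eq_bigr => l _; exact: mulrC.
  under eq_bigr do rewrite mulr_suml.
  rewrite exchange_big -sumrN; apply: eq_bigr => m _ /=.
  rewrite mulrC -mulrN -dyL mulr_sumr; apply: eq_bigr => l _.
  by rewrite -mulrA; apply: f_equal; exact: mulrC.
- under eq_bigr do rewrite mulr_suml.
  rewrite exchange_big big1 // => m _ /=.
  refine (etrans _ (etrans (congr1 ( *%R (connection F m i k z)) (landsberg_y m j Uz)) (mulr0 _))).
  by rewrite mulr_sumr; apply: eq_bigr => l _; ring.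
- under eq_bigr do rewrite mulr_suml.
  rewrite exchange_big big1 // => m _ /=.
  refine (etrans _ (etrans (congr1 ( *%R (connection F m j k z)) (landsberg_y i m Uz)) (mulr0 _))).
  by rewrite mulr_sumr; apply: eq_bigr => l _; ring.
- under eq_bigr do rewrite mulr_suml.
  rewrite exchange_big; apply: eq_bigr => m _ /=.
  rewrite -(euler_dspray oU sE metric_unit eulerE m k Uz) mulr_sumr.
  by apply: eq_bigr => l _; rewrite -mulrA; apply: f_equal; exact: mulrC.
Qed.

Hypothesis stretch0 : forall z, U z -> forall i j k l, stretch F i j k l z = 0.

(** Vanishing stretch curvature makes the horizontal derivative of the
    Landsberg tensor symmetric in its last two slots, and the position vector
    is horizontally constant and annihilated by the Landsberg tensor. *)
Lemma landsberg_transport i j k z : U z -> spray_field F (landsberg F i j k) z =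
  \sum_m landsberg F m j k z * dy i (G m) z + \sum_m landsberg F i m k z * dy j (G m) z
  + \sum_m landsberg F i j m z * dy k (G m) z.
Proof.
move=> Uz; have alg (s s' x a b c : R) : s = x - a - b - c -> s = s' -> s' = 0 ->
  x = a + b + c by move=> *; lra.
apply: alg (hcov3_spray (landsberg F) i j k Uz) _ (landsberg_hcov_y i j k Uz).
apply: eq_bigr => s _; apply: (f_equal ( *%R^~ _)); apply/eqP; rewrite -subr_eq0.
by have /eqP := stretch0 Uz i j k s; rewrite mulf_eq0 pnatr_eq0.
Qed.

End LandsbergCurvature.

(** * Ordinary differential equations *)

Section RealOde.
Context {R : realType}.
Implicit Types (f g : R -> R) (a b t : R).

Lemma MVT_le f (f' : R -> R) a b : a <= b ->
  (forall t, a < t < b -> is_derive t 1 f (f' t)) -> {within `[a, b], continuous f} ->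
  (forall t, a < t < b -> f' t <= 0) -> f b <= f a.
Proof.
rewrite le_eqVlt => /predU1P[-> // | ab] df cf f'0.
have [t tab E] : exists2 c, c \in `]a, b[ & f b - f a = f' c * (b - a).
  by apply: MVT => // t; rewrite in_itv /=; exact: df.
rewrite -subr_le0 E; move: tab; rewrite in_itv /= => tab.
by rewrite mulr_le0_ge0 ?f'0 // subr_ge0 ltW.
Qed.

Lemma is_derive_within_continuous f (f' : R -> R) a b :
  (forall t, a <= t <= b -> is_derive t 1 f (f' t)) -> {within `[a, b], continuous f}.
Proof.
move=> df; apply: derivable_within_continuous => t; rewrite in_itv /= => /df.
by case.
Qed.

Lemma is_derive_mul f g (f' g' : R) t : is_derive t 1 f f' -> is_derive t 1 g g' ->
  is_derive t 1 (fun s => f s * g s) (f t * g' + g t * f').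
Proof. by move=> df dg; exact: (@is_deriveM _ _ f g t 1 f' g' df dg). Qed.

Lemma is_derive_add f g (f' g' : R) t : is_derive t 1 f f' -> is_derive t 1 g g' ->
  is_derive t 1 (fun s => f s + g s) (f' + g').
Proof. by move=> df dg; exact: (@is_deriveD _ _ _ f g t 1 f' g' df dg). Qed.

Lemma is_derive_opp f (f' : R) t : is_derive t 1 f f' -> is_derive t 1 (fun s => - f s) (- f').
Proof. by move=> df; exact: (@is_deriveN _ _ _ f t 1 f' df). Qed.

Lemma is_derive_sub f g (f' g' : R) t : is_derive t 1 f f' -> is_derive t 1 g g' ->
  is_derive t 1 (fun s => f s - g s) (f' - g').
Proof. by move=> df dg; exact: (is_derive_add df (is_derive_opp dg)). Qed.

Lemma is_derive_bigsum (I : Type) (r : seq I) (f : I -> R -> R) (f' : I -> R) t :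
  (forall q, is_derive t 1 (f q) (f' q)) ->
  is_derive t 1 (fun s => \sum_(q <- r) f q s) (\sum_(q <- r) f' q).
Proof.
move=> df; elim: r => [|q r IH].
  rewrite big_nil; have := @is_derive_cst _ _ _ (0 : R) t 1.
  by congr is_derive; apply/funext => s; rewrite big_nil.
rewrite big_cons; have := is_derive_add (df q) IH.
by congr is_derive; apply/funext => s; rewrite big_cons.
Qed.

Lemma is_derive_const (c : R) t : is_derive t 1 (fun _ : R => c) 0.
Proof. exact: is_derive_cst. Qed.

Lemma is_derive_ident t : is_derive t 1 (fun s : R => s) 1.
Proof. exact: is_derive_id. Qed.

Lemma is_derive_expRM (c t : R) :
  is_derive t 1 (fun s => expR (c * s)) (c * expR (c * t)).
Proof.
have dc : is_derive t 1 (fun s => c * s) (c * 1 + t * 0).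
  exact: (is_derive_mul (is_derive_const c t) (is_derive_ident t)).
rewrite mulr1 mulr0 addr0 in dc.
by rewrite [X in is_derive _ _ _ X]mulrC; exact: (is_derive1_comp (is_derive_expR (c * t)) dc).
Qed.

(** Comparison with an exponential on either side of the zero. *)
Lemma gronwall_zero f (f' : R -> R) (K : R) t0 d :
  (forall t, `|t - t0| < d -> [/\ is_derive t 1 f (f' t), 0 <= f t & `|f' t| <= K * f t]) ->
  f t0 = 0 -> forall t, `|t - t0| < d -> f t = 0.
Proof.
move=> H f0 t td; have [_ ft0 _] := H t td.
apply/eqP; rewrite eq_le ft0 andbT.
have dprod (c s : R) : `|s - t0| < d ->
    is_derive s 1 (fun s => f s * expR (c * s)) ((f' s + c * f s) * expR (c * s)).
  move=> sd; have [df _ _] := H s sd.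
  have := is_derive_mul df (is_derive_expRM c s).
  by congr is_derive; ring.
have [tt0|/ltW tt0] := leP t0 t.
- have near_t0 s : t0 <= s <= t -> `|s - t0| < d.
    move=> /andP[ts st]; rewrite ger0_norm ?subr_ge0 //.
    by apply: le_lt_trans td; rewrite ger0_norm ?subr_ge0 // lerB.
  have dP s : t0 <= s <= t -> is_derive s 1 (fun s => f s * expR (- K * s))
      ((f' s + - K * f s) * expR (- K * s)).
    by move=> /near_t0; exact: dprod.
  have : f t * expR (- K * t) <= f t0 * expR (- K * t0).
    apply: (MVT_le tt0 _ (is_derive_within_continuous dP)) => s /andP[s1 s2].
      by apply: dP; rewrite !ltW.
    have [|_ _ H'] := H s; first by apply: near_t0; rewrite !ltW.
    rewrite mulr_le0_ge0 ?expR_ge0 // mulNr subr_le0.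
    exact: le_trans (ler_norm _) H'.
  by rewrite f0 mul0r pmulr_lle0 ?expR_gt0.
- have near_t0 s : t <= s <= t0 -> `|s - t0| < d.
    move=> /andP[ts st]; rewrite ler0_norm ?subr_le0 //.
    by apply: le_lt_trans td; rewrite ler0_norm ?subr_le0 // lerN2 lerB.
  have dP s : t <= s <= t0 -> is_derive s 1 (fun s => - (f s * expR (K * s)))
      (- ((f' s + K * f s) * expR (K * s))).
    by move=> /near_t0 sd; apply: is_derive_opp; exact: dprod.
  have : - (f t0 * expR (K * t0)) <= - (f t * expR (K * t)).
    apply: (MVT_le tt0 _ (is_derive_within_continuous dP)) => s /andP[s1 s2].
      by apply: dP; rewrite !ltW.
    have [|_ _ H'] := H s; first by apply: near_t0; rewrite !ltW.
    rewrite oppr_le0 mulr_ge0 ?expR_ge0 // addrC -lerBlDr sub0r.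
    by apply: le_trans H'; rewrite -normrN ler_norm.
  by rewrite f0 mul0r oppr0 oppr_ge0 pmulr_lle0 ?expR_gt0.
Qed.

Lemma antiderivative g a : continuous g ->
  exists G, forall t, a < t -> is_derive t 1 G (g t).
Proof.
move=> cg; exists (fun x => \int[lebesgue_measure]_(t in `[a, x]) g t)%R => t at0.
have t1 : t < t + 1 by rewrite ltrDl.
have ig : lebesgue_measure.-integrable `[a, t + 1] (EFin \o g).
  apply: continuous_compact_integrable; first exact: segment_compact.
  by apply: continuous_subspaceT => x; exact: cg.
have [dG dGE] := continuous_FTC1_closed t1 ig at0 (cg t).
apply: DeriveDef; first exact: dG.
exact: etrans (esym (derive1E _ _)) dGE.
Qed.

(** The intervals of radius 2 e / 2^k around u k are nested; the limit is the
    supremum of their left ends. *)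
Lemma dyadic_limit (u : nat -> R) (e : R) :
  (forall k, `|u k.+1 - u k| <= e / 2 ^+ k) -> exists l, forall k, `|l - u k| <= 2 * e / 2 ^+ k.
Proof.
move=> uP; pose r k := 2 * e / 2 ^+ k.
have rS k : r k.+1 + e / 2 ^+ k = r k.
  by rewrite /r exprS; field; exact: expf_neq0.
have lowS k : u k - r k <= u k.+1 - r k.+1.
  by have := uP k; rewrite ler_norml -(rS k) => /andP[]; lra.
have upS k : u k.+1 + r k.+1 <= u k + r k.
  by have := uP k; rewrite ler_norml -(rS k) => /andP[]; lra.
have r0 k : 0 <= r k.
  have e0 : 0 <= e by have := uP 0%N; rewrite expr0 divr1; exact: le_trans.
  by rewrite /r divr_ge0 ?mulr_ge0 // exprn_ge0.
have lowD k m : u k - r k <= u (k + m)%N - r (k + m)%N.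
  by elim: m => [|m IH]; rewrite ?addn0 // addnS; exact: le_trans IH (lowS _).
have upD k m : u (k + m)%N + r (k + m)%N <= u k + r k.
  by elim: m => [|m IH]; rewrite ?addn0 // addnS; exact: le_trans (upS _) IH.
have low_up j k : u j - r j <= u k + r k.
  apply: le_trans (lowD j k) _; apply: le_trans (_ : u (j + k)%N + r (j + k)%N <= _).
    by have := r0 (j + k)%N; lra.
  by rewrite addnC; exact: upD.
pose S := [set u k - r k | k in [set: nat]].
have supS : has_sup S.
  split; first by exists (u 0%N - r 0%N), 0%N.
  by exists (u 0%N + r 0%N) => _ [k _ <-].
exists (sup S) => k; rewrite ler_norml; apply/andP; split.
  have : u k - r k <= sup S by apply: (ub_le_sup supS.2); exists k.
  by rewrite -/(r k); lra.
have : sup S <= u k + r k.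
  by apply: ge_sup; [exact: supS.1|move=> _ [j _ <-]].
by rewrite -/(r k); lra.
Qed.

Lemma le0_dyadic (x C : R) : (forall k, x <= C / 2 ^+ k) -> x <= 0.
Proof.
move=> H; rewrite leNgt; apply/negP => x0.
have C0 : 0 < C by have := H 0%N; rewrite expr0 divr1; exact: lt_le_trans.
have := H (Num.bound (C / x)); rewrite leNgt => /negP; apply.
rewrite ltr_pdivrMr ?exprn_gt0 // mulrC -ltr_pdivrMr //.
apply: lt_le_trans (archi_boundP _) _; first by rewrite divr_ge0 ?ltW.
by rewrite -natrX ler_nat ltnW // ltn_expl.
Qed.

End RealOde.

Section Clamp.
Context {R : realType}.

(** Projection onto the interval [-r, r]; composing with it turns local
    Lipschitz data into global ones. *)
Definition clamp (r t : R) := Num.max (- r) (Num.min r t).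

Lemma clamp_id (r t : R) : `|t| <= r -> clamp r t = t.
Proof. by rewrite ler_norml /clamp => /andP[? ?]; rewrite min_r // max_r. Qed.

Lemma clamp_le (r t : R) : 0 <= r -> `|clamp r t| <= r.
Proof.
move=> r0; rewrite ler_norml /clamp le_max lexx /= ge_max; apply/andP; split.
  by rewrite ge0_cp.
by rewrite ge_min lexx.
Qed.

Lemma clamp_dist (r t s : R) : 0 <= r -> `|clamp r t - clamp r s| <= `|t - s|.
Proof.
move=> r0; wlog ts : t s / t <= s.
  by move=> W; have [/W//|/ltW/W] := leP t s; rewrite distrC [`|s - t|]distrC.
rewrite [leRHS]distrC (@ger0_norm _ (s - t)) ?subr_ge0 // ler_norml /clamp !maxEle !minEle.
by case: (leP r t) => ?; case: (leP r s) => ?; apply/andP; split; do !(case: (leP (- r)) => ?); lra.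
Qed.

End Clamp.

Lemma lipschitz_continuous (R : realType) (f : R -> R) (K : R) :
  (forall t s, `|f t - f s| <= K * `|t - s|) -> continuous f.
Proof.
move=> fK t; apply/cvgrPdist_le => e e0.
pose r := e / (`|K| + 1); have K1 : 0 < `|K| + 1 by rewrite ltr_wpDl.
have r0 : 0 < r by rewrite divr_gt0.
near=> s.
have ts : `|t - s| <= r by near: s; apply: cvgr_dist_le => //; exact: cvg_id.
apply: le_trans (fK t s) _; have -> : e = (`|K| + 1) * r.
  by rewrite /r mulrC divfK ?gt_eqF.
apply: le_trans (ler_wpM2r (normr_ge0 _) (ler_norm K)) _.
by apply: ler_pM => //; rewrite lerDl.
Unshelve. all: by end_near. Qed.

Section Picard.
Context {R : realType} {T : Type}.
Implicit Types (u v : R -> T -> R) (t s : R) (i : T).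

Variables (h : (T -> R) -> T -> R) (w0 : T -> R) (L B : R).
Hypothesis L0 : 0 < L.
Hypothesis hL : forall (w v : T -> R) (e : R), (forall i, `|w i - v i| <= e) ->
  forall i, `|h w i - h v i| <= L * e.
Hypothesis hB : forall w i, `|h w i| <= B.

(* On an interval of this radius the Picard iteration halves distances. *)
Let d := (2 * L)^-1.
Let d0 : 0 < d. Proof. by rewrite invr_gt0 mulr_gt0. Qed.

Let B0 i : 0 <= B. Proof. exact: le_trans (normr_ge0 _) (hB w0 i). Qed.

(** The space of curves in which the iteration takes place; the common Lipschitz
    constant is inherited by limits. *)
Definition lipschitz_from u : Prop :=
  (forall i, u 0 i = w0 i) /\ (forall t s i, `|u t i - u s i| <= B * `|t - s|).

(** Together with [lipschitz_from v], this says that v is the Picard iterate of u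
    on [-d, d], continued by constants so that the iteration can be repeated. *)
Definition picard_step u v : Prop :=
  (forall t i, `|t| < d -> is_derive t 1 (fun s => v s i) (h (u t) i)) /\
  (forall t, v t = v (clamp d t)).

Lemma picard_step_exists u : lipschitz_from u ->
  exists v, lipschitz_from v /\ picard_step u v.
Proof.
move=> [u0 uB].
have ch i : continuous (fun t => h (u t) i).
  apply: (@lipschitz_continuous _ _ (L * B)) => t s.
  by rewrite -mulrA; apply: hL => j; exact: uB.
have [G dG] := choice (fun i => antiderivative (- 2 * d) (ch i)).
have dd s : `|s| <= d -> - 2 * d < s.
  by rewrite ler_norml => /andP[sd _]; apply: lt_le_trans sd; have := d0; lra.
have GB i t s : `|t| <= d -> `|s| <= d -> `|G i t - G i s| <= B * `|t - s|.
  wlog ts : t s / t < s => [W td sd|td sd].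
    have [/W//|/W|->] := ltgtP t s; last by rewrite !subrr normr0 mulr0.
      exact.
    by rewrite distrC [`|s - t|]distrC; exact.
  have dst x : t <= x <= s -> is_derive x 1 (G i) (h (u x) i).
    move=> /andP[tx _]; apply: dG; apply: lt_le_trans tx; exact: dd.
  have [x _ E] : exists2 x, x \in `]t, s[ & G i s - G i t = h (u x) i * (s - t).
    apply: MVT => // [x|]; last exact: is_derive_within_continuous dst.
    by rewrite in_itv /= => /andP[? ?]; apply: dst; rewrite !ltW.
  by rewrite distrC E normrM [`|t - s|]distrC ler_wpM2r.
have cl s : `|clamp d s| <= d by rewrite clamp_le // ltW.
have c0 : clamp d 0 = 0 by rewrite clamp_id // normr0 ltW.
exists (fun t i => w0 i + (G i (clamp d t) - G i 0)); split; split.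
- by move=> i; rewrite c0 subrr addr0.
- move=> t s i; have E (a b c e : R) : a + (b - c) - (a + (e - c)) = b - e by ring.
  rewrite E.
  apply: le_trans (GB i _ _ (cl _) (cl _)) _.
  by apply: ler_wpM2l; [exact: B0 i|apply: clamp_dist; exact: ltW].
- move=> t i td.
  have dF : is_derive t 1 (fun s => w0 i + (G i s - G i 0)) (0 + (h (u t) i - 0)).
    apply: is_derive_add; apply: is_derive_sub.
    by apply: dG; apply: dd; exact: ltW.
  rewrite add0r subr0 in dF; apply: near_eq_is_derive dF.
  have : (ball t (d - `|t|)) `<=` [set s | w0 i + (G i s - G i 0) =
      w0 i + (G i (clamp d s) - G i 0)].
    move=> s; rewrite -ball_normE /= => ts; rewrite clamp_id //.
    have := ler_distD t s 0; rewrite !subr0 => H.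
    by apply: le_trans H _; rewrite distrC -lerBrDr ltW.
  by move=> H; apply: (filterS H); apply: nbhsx_ballx; rewrite subr_gt0.
- by move=> t /=; rewrite (clamp_id (cl t)).
Qed.

Lemma picard_step_contracts u v (u' v' : R -> T -> R) (e : R) : lipschitz_from v -> lipschitz_from v' ->
  picard_step u v -> picard_step u' v' ->
  (forall t i, `|u t i - u' t i| <= e) -> forall t i, `|v t i - v' t i| <= e / 2.
Proof.
move=> [v0 vB] [v'0 v'B] [dv cv] [dv' cv'] ue t i.
have e0 : 0 <= e by exact: le_trans (ue 0 i).
have LE x j : `|h (u x) j - h (u' x) j| <= L * e by exact: hL.
rewrite cv cv'; move: (clamp d t) (clamp_le t (ltW d0)) => {}t td.
have dw (x : R) : `|x| < d -> is_derive x 1 (fun s => v s i - v' s i) (h (u x) i - h (u' x) i).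
  by move=> xd; apply: is_derive_sub; [exact: dv|exact: dv'].
have cw : continuous (fun s : R => v s i - v' s i).
  apply: (@lipschitz_continuous _ _ (B + B)) => x z.
  have E (a b c f : R) : a - b - (c - f) = (a - c) - (b - f) by ring.
  rewrite E mulrDl; apply: le_trans (ler_normB _ _) _.
  exact: lerD (vB _ _ _) (v'B _ _ _).
have w0E : v 0 i - v' 0 i = 0 by rewrite v0 v'0 subrr.
suff bound : `|v t i - v' t i| <= L * e * `|t|.
  apply: le_trans bound _; apply: le_trans (ler_wpM2l _ td) _.
    by rewrite mulr_ge0 // ltW.
  rewrite /d le_eqVlt; apply/orP; left; apply/eqP; field; exact: lt0r_neq0.
have [t0|t0|->] := ltgtP t 0; last first.
- by rewrite w0E normr0 mulr0.
- have [x x0 E] : exists2 x, x \in `]0, t[ & v t i - v' t i - (v 0 i - v' 0 i) =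
      (h (u x) i - h (u' x) i) * (t - 0).
    apply: (@MVT R (fun s => v s i - v' s i) (fun x => h (u x) i - h (u' x) i)) => //;
      last by apply: continuous_subspaceT => x; exact: cw.
    move=> x; rewrite in_itv /= => /andP[x0 xt]; apply: dw.
    by rewrite gtr0_norm //; apply: lt_le_trans xt _; exact: le_trans (ler_norm _) td.
  by move: E; rewrite w0E !subr0 => ->; rewrite normrM ler_wpM2r.
- have [x x0 E] : exists2 x, x \in `]t, 0[ & v 0 i - v' 0 i - (v t i - v' t i) =
      (h (u x) i - h (u' x) i) * (0 - t).
    apply: (@MVT R (fun s => v s i - v' s i) (fun x => h (u x) i - h (u' x) i)) => //;
      last by apply: continuous_subspaceT => x; exact: cw.
    move=> x; rewrite in_itv /= => /andP[x0 xt]; apply: dw.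
    rewrite ltr0_norm //; apply: lt_le_trans td; rewrite ltr0_norm //.
    by rewrite ltrN2.
  by move: E; rewrite w0E !sub0r mulrN => /oppr_inj ->; rewrite normrM ler_wpM2r.
Qed.

(** The iterates from the constant curve converge geometrically; the limit is a
    fixed point, since its own iterate is at distance 0 from it. *)
Theorem picard : exists d' u, [/\ 0 < d', forall i, u 0 i = w0 i,
  forall t i, `|u t i - w0 i| <= B * `|t| &
  forall t i, `|t| < d' -> is_derive t 1 (fun s => u s i) (h (u t) i)].
Proof.
pose S := {u | lipschitz_from u}.
have ex (U : S) : exists W : S, picard_step (sval U) (sval W).
  case: U => u lu; have [v [lv uv]] := picard_step_exists lu.
  by exists (exist _ v lv).
have [step stepP] := choice ex.
have l0 : lipschitz_from (fun=> w0).
  by split => // t s i; rewrite subrr normr0 mulr_ge0 // (B0 i).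
pose u k := sval (iter k step (exist _ _ l0)).
have lu k : lipschitz_from (u k) by exact: svalP.
have su k : picard_step (u k) (u k.+1) by exact: stepP.
have u_dist k t i : `|u k.+1 t i - u k t i| <= (B * d) / 2 ^+ k.
  elim: k t i => [|k IH] t i.
    rewrite expr0 divr1 -[u 0%N t i]/(w0 i) -(proj1 (lu 1%N)) (proj2 (su 0%N)).
    apply: le_trans (proj2 (lu 1%N) _ _ _) _; rewrite subr0.
    by apply: ler_wpM2l; [exact: B0 i|apply: clamp_le; exact: ltW].
  rewrite exprSr invfM mulrA.
  exact: (picard_step_contracts (lu k.+2) (lu k.+1) (su k.+1) (su k) IH).
have lim_u (ti : R * T) : exists l, forall k, `|l - u k ti.1 ti.2| <= 2 * (B * d) / 2 ^+ k.
  exact: dyadic_limit (fun k => u_dist k ti.1 ti.2).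
have [l lP] := choice lim_u; pose ul t i := l (t, i).
have ulP k t i : `|ul t i - u k t i| <= 2 * (B * d) / 2 ^+ k by exact: (lP (t, i)).
have lul : lipschitz_from ul.
  split=> [i|t s i].
    apply/eqP; rewrite -subr_eq0 -normr_le0; apply: (@le0_dyadic _ _ (2 * (B * d))) => k.
    by have := ulP k 0 i; rewrite (proj1 (lu k)).
  rewrite -subr_le0; apply: (@le0_dyadic _ _ (4 * (B * d))) => k.
  have := ulP k t i; have := ulP k s i; have := proj2 (lu k) t s i.
  move: (B * `|t - s|) => b; rewrite lerBlDr.
  have -> : 4 * (B * d) / 2 ^+ k = 2 * (B * d) / 2 ^+ k + 2 * (B * d) / 2 ^+ k by ring.
  rewrite -[`|ul s i - _|]normrN => h1 h2 h3.
  have -> : ul t i - ul s i = (ul t i - u k t i) + (- (ul s i - u k s i)) + (u k t i - u k s i) by ring.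
  apply: le_trans (ler_normD _ _) _; apply: lerD => //.
  by apply: le_trans (ler_normD _ _) _; exact: lerD.
have [v [lv sv]] := picard_step_exists lul.
have vE t i : v t i = ul t i.
  apply/eqP; rewrite -subr_eq0 -normr_le0; apply: (@le0_dyadic _ _ (2 * (B * d))) => k.
  have H := picard_step_contracts lv (lu k.+1) sv (su k) (ulP k) t i.
  have H' := ulP k.+1 t i; rewrite distrC in H'.
  have -> : v t i - ul t i = (v t i - u k.+1 t i) + (u k.+1 t i - ul t i) by ring.
  apply: le_trans (ler_normD _ _) _; apply: le_trans (lerD H H') _.
  by rewrite exprS le_eqVlt; apply/orP; left; apply/eqP; field; exact: expf_neq0.
exists d, ul; split=> // [i|t i|t i td]; first exact: (proj1 lul).
  by have := proj2 lul t 0 i; rewrite (proj1 lul) subr0.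
have := proj1 sv t i td; congr is_derive.
by apply/funext => s; rewrite vE.
Qed.

End Picard.

(** * Curves in the tangent bundle of a chart *)

Section Curves.
Context {R : realType}.

Lemma is_derive_chain (V W : normedModType R) (f : V -> W) (z : R -> V) (t : R) v :
  is_derive t 1 z v -> differentiable f (z t) ->
  is_derive t 1 (fun s => f (z s)) ('D_v f (z t)).
Proof.
move=> [dz zE] df; have dz' : differentiable z t by exact/derivable1_diffP.
have dfz : differentiable (f \o z) t by exact: differentiable_comp.
apply: DeriveDef; first exact/derivable1_diffP.
rewrite -[LHS]/('D_1 (f \o z) t) deriveE // (diff_comp dz' df) /=.
by rewrite -(deriveE _ dz') zE deriveE.
Qed.

Lemma is_derive_pair (V W : normedModType R) (x : R -> V) (y : R -> W) (t : R) v w :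
  is_derive t 1 x v -> is_derive t 1 y w -> is_derive t 1 (fun s => (x s, y s)) (v, w).
Proof.
move=> [dx xE] [dy yE].
have dx' : differentiable x t by exact/derivable1_diffP.
have dy' : differentiable y t by exact/derivable1_diffP.
apply: DeriveDef; first exact/derivable1_diffP/differentiable_pair.
rewrite deriveE; last exact: differentiable_pair.
by rewrite (diff_pair dx' dy') -!deriveE // xE yE.
Qed.

Lemma is_derive_rV n (x : R -> 'rV[R]_n) (t : R) (v : 'rV[R]_n) :
  is_derive t 1 x v <-> forall i, is_derive t 1 (fun s => x s 0 i) (v 0 i).
Proof.
split=> [[dx <-] i|dx].
  apply: DeriveDef; first by have /derivable_mxP := dx; apply.
  by rewrite (derive_mx dx) mxE.
have dx' : derivable x t 1.
  by apply/derivable_mxP => i j; rewrite (ord1 i); case: (dx j).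
apply: DeriveDef => //; apply/matrixP => i j; rewrite (derive_mx dx') mxE (ord1 i).
by case: (dx j).
Qed.

Lemma sum_pairl (V W : zmodType) n (f : 'I_n -> V) :
  (\sum_i f i, 0 : W) = \sum_i (f i, 0).
Proof. by elim/big_rec2: _ => // i u v _ <-; congr pair; rewrite addr0. Qed.

Lemma sum_pairr (V W : zmodType) n (f : 'I_n -> W) :
  (0 : V, \sum_i f i) = \sum_i (0, f i).
Proof. by elim/big_rec2: _ => // i u v _ <-; congr pair; rewrite addr0. Qed.

Context {n : nat}.
Local Notation V := ('rV[R]_n * 'rV[R]_n)%type.
Implicit Types (f g : V -> R) (z u : V).

Lemma derive_coordinates f z u : differentiable f z ->
  'D_u f z = \sum_i u.1 0 i * dx i f z + \sum_i u.2 0 i * dy i f z.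
Proof.
move=> df; rewrite deriveE //; case: u => u1 u2 /=.
have -> : (u1, u2) = (u1, 0) + (0, u2) by congr pair; rewrite ?addr0 ?add0r.
rewrite linearD; congr (_ + _).
  rewrite {1}(row_sum_delta u1) sum_pairl linear_sum; apply: eq_bigr => i _.
  have -> : (u1 0 i *: delta_mx 0 i, 0) = u1 0 i *: (delta_mx 0 i, 0) :> V.
    by congr pair; rewrite scaler0.
  by rewrite linearZ /dx deriveE.
rewrite {1}(row_sum_delta u2) sum_pairr linear_sum; apply: eq_bigr => i _.
have -> : (0, u2 0 i *: delta_mx 0 i) = u2 0 i *: (0, delta_mx 0 i) :> V.
  by congr pair; rewrite scaler0.
by rewrite linearZ /dy deriveE.
Qed.

Lemma is_derive_curve f (x y : R -> 'rV[R]_n) (t : R) (v w : 'rV[R]_n) :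
  is_derive t 1 x v -> is_derive t 1 y w -> differentiable f (x t, y t) ->
  is_derive t 1 (fun s => f (x s, y s))
    (\sum_i v 0 i * dx i f (x t, y t) + \sum_i w 0 i * dy i f (x t, y t)).
Proof.
move=> xv yw df; have := is_derive_chain (is_derive_pair xv yw) df.
by rewrite derive_coordinates.
Qed.

(** When f agrees with g along a curve issuing from z, its directional
    derivative is computed from the partial derivatives of g. *)
Lemma derive_along_curve f g z u (x y : R -> 'rV[R]_n) (v w : 'rV[R]_n) :
  derivable f z u -> (\forall s \near 0, f (z + s *: u) = g (x s, y s)) ->
  is_derive (0 : R) 1 x v -> is_derive (0 : R) 1 y w -> differentiable g (x 0, y 0) ->
  'D_u f z = \sum_i v 0 i * dx i g (x 0, y 0) + \sum_i w 0 i * dy i g (x 0, y 0).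
Proof.
move=> df fg xv yw dg.
have df0 : derivable f (z + (0 : R) *: u) u by rewrite scale0r addr0.
have := near_eq_is_derive fg (is_derive_line df0); rewrite scale0r addr0 => -[_ <-].
by have [_ ->] := is_derive_curve xv yw dg.
Qed.

End Curves.

Section LocalFlow.
Context {R : realType} {n : nat}.
Local Notation V := ('rV[R]_n * 'rV[R]_n)%type.

Lemma locally_bounded (T : finType) (W : normedModType R) (g : T -> W -> R) (z0 : W) :
  (forall c, {for z0, continuous (g c)}) ->
  exists2 K, 0 <= K & \forall z \near z0, forall c, `|g c z| <= K.
Proof.
move=> cg; exists (\sum_c (`|g c z0| + 1)); first by apply: sumr_ge0 => c _; rewrite addr_ge0.
apply: filter_forall => c.
have /cvgrPdist_le/(_ 1 ltr01) : g c @ z0 --> g c z0 by exact: cg.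
apply: filterS => z zc; rewrite (bigD1 c) //= -[leLHS]addr0; apply: lerD; last first.
  by apply: sumr_ge0 => j _; rewrite addr_ge0.
rewrite -(subrK (g c z0) (g c z)) addrC; apply: le_trans (ler_normD _ _) _.
by rewrite lerD2l distrC.
Qed.

Lemma rV_norm_le (r : R) (x : 'rV[R]_n) : 0 <= r -> (forall i, `|x 0 i| <= r) -> `|x| <= r.
Proof.
move=> r0 xr; rewrite [leLHS]/Num.Def.normr/= mx_normrE.
by apply: bigmax_le => // -[i j] _; rewrite (ord1 i).
Qed.

Definition point_of (w : 'I_n + 'I_n -> R) : V :=
  (\row_i w (inl i), \row_i w (inr i)).

(** Composed with the projection onto a small box around z0, the vector field
    becomes bounded and globally Lipschitz; the solution of the modified
    equation stays in the box for a short time. *)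
Theorem local_flow (U : set V) (H : 'I_n + 'I_n -> V -> R) z0 :
  open U -> (forall c, smooth U (H c)) -> U z0 ->
  exists d (x y : R -> 'rV[R]_n), [/\ 0 < d, x 0 = z0.1, y 0 = z0.2 &
    forall t, `|t| < d -> [/\ U (x t, y t),
      is_derive t 1 x (\row_i H (inl i) (x t, y t)) &
      is_derive t 1 y (\row_i H (inr i) (x t, y t))]].
Proof.
move=> oU sH Uz0.
have [K1 K10 nK1] := locally_bounded (fun c => smooth_continuous (sH c) Uz0).
have [K2 K20 nK2] := locally_bounded (fun ci : ('I_n + 'I_n) * 'I_n =>
  smooth_continuous (smooth_dx ci.2 (sH ci.1)) Uz0).
have [K3 K30 nK3] := locally_bounded (fun ci : ('I_n + 'I_n) * 'I_n =>
  smooth_continuous (smooth_dy ci.2 (sH ci.1)) Uz0).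
have [r0 r00 rP] : exists2 r, 0 < r & forall z, `|z - z0| < r -> [/\ U z,
    forall c, `|H c z| <= K1, forall c i, `|dx i (H c) z| <= K2 &
    forall c i, `|dy i (H c) z| <= K3].
  have : nbhs z0 (U `&` [set z | forall c, `|H c z| <= K1]
    `&` [set z | forall ci : ('I_n + 'I_n) * 'I_n, `|dx ci.2 (H ci.1) z| <= K2]
    `&` [set z | forall ci : ('I_n + 'I_n) * 'I_n, `|dy ci.2 (H ci.1) z| <= K3]).
    by do 3 (apply: filterI => //); exact: open_nbhs_nbhs.
  move=> /nbhs_ballP[r /= r_gt0 rP]; exists r => // z zr.
  have [|[[Uz h1] h2] h3] := rP z; first by rewrite -ball_normE /= distrC.
  by split; [exact: Uz|exact: h1|move=> c i; exact: (h2 (c, i))|move=> c i; exact: (h3 (c, i))].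
pose w0 (c : 'I_n + 'I_n) := match c with inl i => z0.1 0 i | inr i => z0.2 0 i end.
pose r := r0 / 2; have r_gt0 : 0 < r by rewrite divr_gt0.
have rr0 : r < r0 by rewrite /r ltr_pdivrMr // ltr_pMr // ltr1n.
pose box (w : 'I_n + 'I_n -> R) c := w0 c + clamp r (w c - w0 c).
have box_near w : `|point_of (box w) - z0| <= r.
  rewrite prod_normE ge_max; apply/andP; split; apply: rV_norm_le; rewrite ?(ltW r_gt0) // => i.
    by rewrite !mxE /box addrC addKr clamp_le // ltW.
  by rewrite !mxE /box addrC addKr clamp_le // ltW.
pose h w c := H c (point_of (box w)).
pose L := \sum_(i < n) K2 + \sum_(i < n) K3 + 1.
have L0 : 0 < L by rewrite ltr_wpDl // addr_ge0 // sumr_ge0.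
have hB w c : `|h w c| <= K1.
  by have [_ H1 _ _] := rP _ (le_lt_trans (box_near w) rr0); exact: H1.
have hL (w v : 'I_n + 'I_n -> R) (e : R) : (forall c, `|w c - v c| <= e) ->
    forall c, `|h w c - h v c| <= L * e.
  move=> wv c; have e0 : 0 <= e by exact: le_trans (wv c).
  pose p := point_of (box v); pose u := point_of (box w) - p.
  have uE : point_of (box w) = p + (1 : R) *: u by rewrite scale1r /u addrC subrK.
  have seg s : 0 <= s <= 1 -> `|p + s *: u - z0| <= r.
    move=> /andP[s0 s1].
    have -> : p + s *: u - z0 = (1 - s) *: (p - z0) + s *: (point_of (box w) - z0).
      have comb (a b : V) : (1 - s) *: a + s *: b = a + s *: (b - a).
        by rewrite scalerBl scale1r scalerBr -addrA; congr (_ + _); exact: addrC.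
      rewrite comb; have -> : point_of (box w) - z0 - (p - z0) = u by rewrite opprB addrA subrK.
      exact: addrAC.
    apply: le_trans (ler_normD _ _) _; rewrite !normrZ !ger0_norm ?subr_ge0 //.
    have -> : r = (1 - s) * r + s * r by ring.
    by apply: lerD; apply: ler_wpM2l; rewrite ?subr_ge0 //; exact: box_near.
  have Uc s : 0 <= s <= 1 -> U (p + s *: u).
    by move=> /seg sr; have [] := rP _ (le_lt_trans sr rr0).
  have [|s /andP[s0 s1] E] := line_MVT (f := H c) (p := p) (u := u) ltr01.
    by move=> s /Uc; exact: smooth_derivable (sH c).
  have s01 : 0 <= s <= 1 by rewrite !ltW.
  rewrite /h uE E mul1r derive_coordinates; last exact: smooth_differentiable (sH c) (Uc _ s01).
  have [_ _ h2 h3] := rP _ (le_lt_trans (seg s s01) rr0).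
  have box_dist c' : `|box w c' - box v c'| <= e.
    rewrite /box opprD addrACA subrr add0r; apply: le_trans (clamp_dist _ _ (ltW r_gt0)) _.
    by rewrite opprB addrA subrK.
  have ue i : `|u.1 0 i| <= e /\ `|u.2 0 i| <= e.
    by rewrite /u /p /= !mxE; split; exact: box_dist.
  apply: le_trans (ler_normD _ _) _; rewrite /L !mulrDl mul1r !mulr_suml -[leLHS]addr0.
  apply: lerD => //; apply: lerD; apply: le_trans (ler_norm_sum _ _ _) _; apply: ler_sum => i _.
    have [u1 _] := ue i; rewrite normrM mulrC.
    by apply: ler_pM; [exact: normr_ge0|exact: normr_ge0|exact: h2|exact: u1].
  have [_ u2] := ue i; rewrite normrM mulrC.
  by apply: ler_pM; [exact: normr_ge0|exact: normr_ge0|exact: h3|exact: u2].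
have [d [w [d0 w00 wB dw]]] := picard w0 L0 hL hB.
exists (Num.min d (r / (K1 + 1))), (fun t => \row_i w t (inl i)), (fun t => \row_i w t (inr i)).
have K11 : 0 < K1 + 1 by rewrite ltr_wpDl.
split.
- by rewrite lt_min d0 divr_gt0.
- by apply/rowP => i; rewrite mxE w00.
- by apply/rowP => i; rewrite mxE w00.
move=> t; rewrite lt_min => /andP[td tr].
have boxE : box (w t) = w t.
  apply/funext => c; rewrite /box clamp_id; first by rewrite addrC subrK.
  apply: le_trans (wB t c) _; rewrite ltr_pdivlMr // in tr; apply: le_trans (ltW tr).
  by rewrite mulrC; apply: ler_wpM2l => //; rewrite lerDl.
have wz : `|point_of (w t) - z0| < r0 by rewrite -boxE; exact: le_lt_trans (box_near _) rr0.
have [Uw _ _ _] := rP _ wz.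
split => //; apply/is_derive_rV => i.
  have := dw t (inl i) td; rewrite /h boxE mxE.
  by congr is_derive; apply/funext => s; rewrite mxE.
have := dw t (inr i) td; rewrite /h boxE mxE.
by congr is_derive; apply/funext => s; rewrite mxE.
Qed.

End LocalFlow.

(** * Changes of charts *)

Section Charts.
Context {R : realType} {n : nat} {M : manifold R n}.
Implicit Types (p : M) (a b c : chart M) (x y u : 'rV[R]_n) (f : tfun M).

Definition transition a b : 'rV[R]_n -> 'rV[R]_n := chart_map b \o chart_inv a.
Definition overlap a b : set 'rV[R]_n := chart_map a @` (chart_dom a `&` chart_dom b).
Definition transition_coord a b q x : R := transition a b x 0 q.
Definition pd l (g : 'rV[R]_n -> R) x : R := 'D_(delta_mx 0 l) g x.

Lemma overlapP a b x : overlap a b x ->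
  [/\ chart_dom a (chart_inv a x), chart_dom b (chart_inv a x) &
      chart_map a (chart_inv a x) = x].
Proof. by move=> [p [pa pb] <-]; rewrite chart_mapK. Qed.

Lemma overlap_intro a b p : chart_dom a p -> chart_dom b p -> overlap a b (chart_map a p).
Proof. by move=> pa pb; exists p. Qed.

Lemma open_overlap a b : open (overlap a b).
Proof.
rewrite openE => x ox; have [pa pb px] := overlapP ox.
have ix : (chart_map a @` chart_dom a) x by exists (chart_inv a x).
have nb : nbhs (chart_inv a x) (chart_dom b) by apply: open_nbhs_nbhs; split=> //; exact: dom_open.
have nx : nbhs x (chart_map a @` chart_dom a).
  by apply: open_nbhs_nbhs; split=> //; exact: image_open.
have := chart_inv_continuous ix nb; rewrite /= nbhs_simpl => nb'.
apply: filterS (filterI nx nb') => _ [[p' pa' <-]] /=.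
by rewrite chart_mapK // => pb'; exists p'.
Qed.

Lemma open_slit a : open (slit a : set ('rV[R]_n * 'rV[R]_n)).
Proof.
have -> : slit a = (fst @^-1` (chart_map a @` chart_dom a)) `&` (snd @^-1` (~` [set 0])).
  by [].
apply: openI; apply: open_comp.
- by move=> z _; exact: cvg_fst.
- exact: image_open.
- by move=> z _; exact: cvg_snd.
- by apply: closed_openC; exact: accessible_closed_set1 (hausdorff_accessible (@norm_hausdorff _ _)) _.
Qed.

Lemma smooth_coord (U : set 'rV[R]_n) (g : 'rV[R]_n -> 'rV[R]_n) q :
  open U -> smooth U g -> smooth U (fun x => g x 0 q).
Proof.
move=> oU sg k; elim: k g sg => [|k IH] g sg.
  move=> x Ux; apply: (@continuous_comp _ _ _ g (fun v : 'rV[R]_n => v 0 q)).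
    exact: (sg 0%N x Ux).
  exact: coord_continuous.
have dg x : U x -> differentiable g x by case: (sg 1%N) => + _; apply.
split=> [x Ux|v].
  apply: (@differentiable_comp _ _ _ _ g (fun x : 'rV[R]_n => x 0 q)); first exact: dg.
  exact: differentiable_coord.
apply: (Ck_congr oU) (IH (fun x => 'D_v g x) _) => [x Ux|k'].
  by rewrite (derive_mx (diff_derivable (dg x Ux))) mxE.
by case: (sg k'.+1) => _; apply.
Qed.

Lemma smooth_transition a b q : smooth (overlap a b) (transition_coord a b q).
Proof. exact: smooth_coord (@open_overlap a b) (transition_smooth a b). Qed.

Lemma transition_differentiable a b x : overlap a b x -> differentiable (transition a b) x.
Proof. by move=> ox; case: (transition_smooth a b 1%N) => + _; apply. Qed.

Lemma derive_transition a b x y q : overlap a b x ->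
  ('D_y (transition a b) x) 0 q = 'D_y (transition_coord a b q) x.
Proof.
move=> ox; rewrite (derive_mx (diff_derivable (transition_differentiable ox))).
by rewrite mxE.
Qed.

Lemma derive_pd (U : set 'rV[R]_n) (g : 'rV[R]_n -> R) x y : smooth U g -> U x ->
  'D_y g x = \sum_k y 0 k * pd k g x.
Proof.
move=> sg Ux; have dg := smooth_differentiable sg Ux.
rewrite deriveE // {1}(row_sum_delta y) linear_sum; apply: eq_bigr => k _.
by rewrite linearZ /pd deriveE.
Qed.

Lemma transitionK a b x : overlap a b x -> transition b a (transition a b x) = x.
Proof. by move=> /overlapP[pa pb E]; rewrite /transition /= chart_mapK. Qed.

Lemma overlap_transition a b x : overlap a b x -> overlap b a (transition a b x).
Proof. by move=> /overlapP[pa pb _]; exists (chart_inv a x). Qed.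

Lemma derive_transitionK a b x y : overlap a b x ->
  'D_('D_y (transition a b) x) (transition b a) (transition a b x) = y.
Proof.
move=> ox; have [pa pb px] := overlapP ox.
have := transition_chain y pa pb pa; rewrite px => <-.
transitivity ('D_y (id : 'rV[R]_n -> 'rV[R]_n) x); last exact: derive_id.
apply: near_eq_derive; apply: (open_nearE (open_overlap (a := a) (b := b)) ox).
by move=> x' /overlapP[].
Qed.

(** The change of charts of the tangent bundle. *)
Definition tangent_map a b (z : 'rV[R]_n * 'rV[R]_n) : 'rV[R]_n * 'rV[R]_n :=
  (transition a b z.1, 'D_(z.2) (transition a b) z.1).

Lemma tangent_mapK a b z : overlap a b z.1 -> tangent_map b a (tangent_map a b z) = z.
Proof.
by case: z => x y ox; rewrite /tangent_map /= transitionK // derive_transitionK.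
Qed.

Lemma slit_tangent_map a b z : overlap a b z.1 -> z.2 <> 0 -> slit b (tangent_map a b z).
Proof.
move=> oz z0; split.
  by have [_ pb _] := overlapP oz; exists (chart_inv a z.1).
move=> /= E; apply: z0; rewrite -[LHS](derive_transitionK z.2 oz) E.
exact: derive0.
Qed.

(** The other fields of a tangent vector are proofs. *)
Lemma tangent_eq p (v w : tangent p) : (forall a, tcomp v a = tcomp w a) -> v = w.
Proof.
case: v w => [v v1 v2] [w w1 w2] /= vw; have E : v = w by apply/funext.
by case: w / E w1 w2 {vw} => w1 w2; congr Tangent; exact: Prop_irrelevance.
Qed.

Lemma tvec_transition a b p y : chart_dom a p -> chart_dom b p ->
  tvec b p ('D_y (transition a b) (chart_map a p)) = tvec a p y.
Proof.
move=> pa pb; apply: tangent_eq => c; rewrite /= /tvec_comp.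
have [pc|npc] := pselect (chart_dom c p); last by rewrite !asboolF // => -[].
rewrite asboolT; last by split.
rewrite asboolT; last by split.
exact: esym (transition_chain y pa pb pc).
Qed.

Lemma tscale_tvec a p (t : R) y : tscale t (tvec a p y) = tvec a p (t *: y).
Proof.
apply: tangent_eq => c; rewrite /= /tvec_comp.
have [[pa pc]|npc] := pselect (chart_dom a p /\ chart_dom c p).
  rewrite !asboolT //.
  by rewrite !deriveE ?linearZ //; exact: transition_diff.
by rewrite !asboolF // scaler0.
Qed.

Lemma local_chart f a p y : chart_dom a p -> local f a (chart_map a p, y) = f p (tvec a p y).
Proof. by move=> pa; rewrite /local /= chart_mapK. Qed.

Lemma local_tangent_map f a b z : overlap a b z.1 ->
  local f b (tangent_map a b z) = local f a z.
Proof.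
case: z => x y /= ox; have [pa pb px] := overlapP ox.
rewrite -{2}px (local_chart f y pa) -(tvec_transition y pa pb) -(local_chart f _ pb).
by rewrite px.
Qed.

End Charts.

Section FinslerCharts.
Context {R : realType} {n : nat} {M : manifold R n}.
Variable F : tfun M.
Hypothesis fF : finsler F.
Implicit Types (a b : chart M).
Local Notation E a := (F2 (local F a)).

Lemma smooth_energy a : smooth (slit a) (E a).
Proof.
exact: smooth_mul (@open_slit _ _ _ a) (finsler_smooth fF a) (finsler_smooth fF a).
Qed.

Lemma posdef_unitmx (A : 'M[R]_n) :
  (forall u : 'rV[R]_n, u <> 0 -> 0 < \sum_i \sum_j A i j * u 0 i * u 0 j) -> A \in unitmx.
Proof.
move=> posA; rewrite -row_free_unit -kermx_eq0; apply/negPn/negP => /rowV0Pn[u].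
move=> /sub_kermxP uA /eqP u0; have := posA u u0.
suff -> : \sum_i \sum_j A i j * u 0 i * u 0 j = 0 by rewrite ltxx.
rewrite exchange_big big1 // => j _ /=.
have := congr1 (fun B : 'rV_n => B 0 j) uA; rewrite !mxE => uAj.
transitivity ((\sum_i u 0 i * A i j) * u 0 j); last by rewrite uAj mul0r.
by rewrite mulr_suml; apply: eq_bigr => i _; rewrite [A i j * _]mulrC.
Qed.

Lemma metric_unitmx a z : slit a z ->
  (\matrix_(i < n, j < n) gmetric (local F a) i j z) \in unitmx.
Proof.
move=> az; apply: posdef_unitmx => u u0.
apply: lt_le_trans (finsler_posdef fF az u0) _.
by apply: ler_sum => i _; apply: ler_sum => j _; rewrite mxE.
Qed.

Lemma energy_scale a x y (t : R) : 0 < t -> E a (x, t *: y) = t ^+ 2 * E a (x, y).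
Proof.
by move=> t0; rewrite /F2 /local /= -tscale_tvec (finsler_homogeneous fF) // exprMn.
Qed.

(** Derivative at s = 0 of E(x, y + s y) = (1 + s)^2 E(x, y). *)
Lemma euler_energy a z : slit a z -> \sum_i ycoord i z * dy i (E a) z = 2 * E a z.
Proof.
move=> az; have dE := smooth_differentiable (smooth_energy a) az.
have := derive_coordinates (0, z.2) dE; rewrite /= [X in _ = X + _]big1 ?add0r => [<-|i _]; last first.
  by rewrite mxE mul0r.
have dl : derivable (E a) (z + (0 : R) *: (0, z.2)) (0, z.2).
  by rewrite scale0r addr0; exact: diff_derivable.
have := is_derive_line dl; rewrite scale0r addr0 => -[_ <-].
have near0 : \forall s \near (0 : R), (1 + s) * (1 + s) * E a z = E a (z + s *: (0, z.2)).
  have : nbhs (0 : R) (ball (0 : R) 1) by exact: nbhsx_ballx.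
  apply: filterS => s; rewrite -ball_normE /= sub0r normrN => s1.
  have s0 : 0 < 1 + s by have := ler_norm (- s); rewrite normrN; lra.
  rewrite -expr2; case: z {az dE dl} => x y /=; rewrite -energy_scale //; congr (F2 _ _).
  have -> : (x, y) + s *: (0, y) = (x + s *: 0, y + s *: y) by [].
  by rewrite scalerDl scale1r scaler0 addr0.
rewrite -(near_eq_derive _ near0).
have d1 : is_derive (0 : R) 1 (fun s : R => 1 + s) (0 + 1).
  exact: is_derive_add (is_derive_const 1 0) (is_derive_ident 0).
have d2 := is_derive_mul (is_derive_mul d1 d1) (is_derive_const (E a z) 0).
by have [_ ->] := d2; ring.
Qed.

Lemma energy_eq0 a x : E a (x, 0) = 0.
Proof.
have := energy_scale a x 0 (ltr0Sn R 1); rewrite scaler0 => H.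
by apply/eqP; move/eqP: H; rewrite -subr_eq0; move: (E a (x, 0)) => e /eqP H; apply/eqP; lra.
Qed.

(** By Euler's relation E is the metric evaluated on the vector y itself. *)
Lemma energy_gt0 a z : slit a z -> 0 < E a z.
Proof.
move=> az; have [_ y0] := az; have := finsler_posdef fF az y0.
suff -> : \sum_i \sum_j gmetric (local F a) i j z * z.2 0 i * z.2 0 j = E a z by [].
have := euler_energy az.
have yl i := ylowE (@open_slit _ _ _ a) (smooth_energy a) (@euler_energy a) i az.
transitivity (\sum_i ycoord i z * ylow (local F a) i z).
  apply: eq_bigr => i _; rewrite mulr_sumr; apply: eq_bigr => j _.
  by rewrite /ycoord mulrCA mulrA.
transitivity (2^-1 * \sum_i ycoord i z * dy i (E a) z); last by rewrite H; field.
by rewrite mulr_sumr; apply: eq_bigr => i _; rewrite yl mulrCA.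
Qed.

Lemma finsler_neq0 a z : slit a z -> local F a z != 0.
Proof. by move=> /energy_gt0; apply: contraTneq; rewrite /F2 => ->; rewrite expr0n ltxx. Qed.

Lemma energy_tangent_map a b z : overlap a b z.1 -> E b (tangent_map a b z) = E a z.
Proof. by move=> oz; rewrite /F2 local_tangent_map. Qed.

End FinslerCharts.

Section TransformationLaws.
Context {R : realType} {n : nat} {M : manifold R n}.
Local Notation V := ('rV[R]_n * 'rV[R]_n)%type.
Variable F : tfun M.
Hypothesis fF : finsler F.
Implicit Types (a b : chart M) (x y : 'rV[R]_n).
Local Notation E a := (F2 (local F a)).

Local Opaque dx dy.

Lemma is_derive_rV_line y u (s : R) : is_derive s 1 (fun s : R => y + s *: u) u.
Proof.
apply/is_derive_rV => i.
have H := is_derive_add (is_derive_const (y 0 i) s)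
  (is_derive_mul (is_derive_ident s) (is_derive_const (u 0 i) s)).
rewrite mulr0 add0r mulr1 add0r in H; move: H.
by congr is_derive; apply/funext => r; rewrite !mxE.
Qed.

(** Along a fibre the change of charts is linear. *)
Lemma fibre_derive a b x (f g : V -> R) l : overlap a b x -> smooth (slit a) f ->
  smooth (slit b) g -> (forall y, y <> 0 -> f (x, y) = g (tangent_map a b (x, y))) ->
  forall y, y <> 0 -> dy l f (x, y) =
    \sum_q pd l (transition_coord a b q) x * dy q g (tangent_map a b (x, y)).
Proof.
move=> ox sf sg fg y y0; pose D := 'D_(delta_mx 0 l) (transition a b) x.
have az : slit a (x, y) by split=> //; have [pa _ px] := overlapP ox; exists (chart_inv a x).
have bz : slit b (tangent_map a b (x, y)) by exact: slit_tangent_map.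
have dT := transition_differentiable ox.
have lin (s : R) : 'D_(y + s *: delta_mx 0 l) (transition a b) x =
    'D_y (transition a b) x + s *: D by rewrite /D !deriveE // linearD linearZ.
have ny : \forall s \near (0 : R), y + s *: (delta_mx 0 l : 'rV[R]_n) <> 0.
  have c : {for (0 : R), continuous (fun s : R => y + s *: (delta_mx 0 l : 'rV[R]_n))}.
    have [d _] := is_derive_rV_line y (delta_mx 0 l) 0.
    exact/differentiable_continuous/derivable1_diffP.
  have : nbhs (y + (0 : R) *: (delta_mx 0 l : 'rV[R]_n)) (~` [set 0]).
    apply: open_nbhs_nbhs; split; last by rewrite /= scale0r addr0.
    by apply: closed_openC; exact: accessible_closed_set1 (hausdorff_accessible (@norm_hausdorff _ _)) _.
  by move=> /c.
have DE0 : 'D_y (transition a b) x + (0 : R) *: D = 'D_y (transition a b) x.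
  by rewrite scale0r addr0.
have curve : \forall s \near (0 : R), f ((x, y) + s *: (0, delta_mx 0 l)) =
    g (transition a b x, 'D_y (transition a b) x + s *: D).
  apply: filterS ny => s ys.
  have -> : (x, y) + s *: (0, delta_mx 0 l) = (x + s *: 0, y + s *: delta_mx 0 l) :> V by [].
  by rewrite scaler0 addr0 fg // /tangent_map /= lin.
have dg : differentiable g (transition a b x, 'D_y (transition a b) x + (0 : R) *: D).
  by rewrite DE0; exact: smooth_differentiable sg bz.
refine (etrans (derive_along_curve (smooth_derivable sf az) curve
  (is_derive_cst (transition a b x) (0 : R) (1 : R)) (is_derive_rV_line _ D 0) dg) _).
rewrite DE0; refine (etrans (congr2 +%R _ _) (add0r _)).
  by apply: big1 => i _; rewrite mxE mul0r.
by apply: eq_bigr => q _; rewrite /D (derive_transition _ _ ox).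
Qed.

Lemma energy_dy a b x y l : overlap a b x -> y <> 0 -> dy l (E a) (x, y) =
  \sum_q pd l (transition_coord a b q) x * dy q (E b) (tangent_map a b (x, y)).
Proof.
move=> ox y0; apply: fibre_derive => //; try exact: smooth_energy.
by move=> y' _; rewrite energy_tangent_map.
Qed.

(** The second sum appears because the linear map between the fibres depends
    on the base point. *)
Lemma energy_dx a b x y l : overlap a b x -> y <> 0 -> dx l (E a) (x, y) =
  \sum_q pd l (transition_coord a b q) x * dx q (E b) (tangent_map a b (x, y)) +
  \sum_q pd l (fun w => 'D_y (transition_coord a b q) w) x
         * dy q (E b) (tangent_map a b (x, y)).
Proof.
move=> ox y0.
have az : slit a (x, y) by split=> //; have [pa _ px] := overlapP ox; exists (chart_inv a x).
have bz : slit b (tangent_map a b (x, y)) by exact: slit_tangent_map.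
pose X (s : R) := transition a b (x + s *: delta_mx 0 l).
pose Y (s : R) := \row_q 'D_y (transition_coord a b q) (x + s *: delta_mx 0 l).
have E0 : x + (0 : R) *: (delta_mx 0 l : 'rV[R]_n) = x by rewrite scale0r addr0.
have no : \forall s \near (0 : R), overlap a b (x + s *: (delta_mx 0 l : 'rV[R]_n)).
  have c : {for (0 : R), continuous (fun s : R => x + s *: (delta_mx 0 l : 'rV[R]_n))}.
    have [d _] := is_derive_rV_line x (delta_mx 0 l) 0.
    exact/differentiable_continuous/derivable1_diffP.
  have : nbhs (x + (0 : R) *: (delta_mx 0 l : 'rV[R]_n)) (overlap a b).
    by apply: open_nbhs_nbhs; split; [exact: open_overlap|rewrite E0].
  by move=> /c.
have XY0 : (X 0, Y 0) = tangent_map a b (x, y).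
  rewrite /X /Y E0 /tangent_map /=; congr pair; apply/rowP => q.
  by rewrite mxE (derive_transition _ _ ox).
have curve : \forall s \near (0 : R), E a ((x, y) + s *: (delta_mx 0 l, 0)) = E b (X s, Y s).
  apply: filterS no => s os.
  have -> : (x, y) + s *: (delta_mx 0 l, 0) = (x + s *: delta_mx 0 l, y + s *: 0) :> V by [].
  rewrite scaler0 addr0.
  refine (etrans (esym (energy_tangent_map F (z := (x + s *: delta_mx 0 l, y)) os)) _).
  congr (F2 _ (_, _)); apply/rowP => q; by rewrite mxE (derive_transition _ _ os).
have dX : is_derive (0 : R) 1 X (\row_q pd l (transition_coord a b q) x).
  apply/is_derive_rV => q; rewrite mxE /pd.
  have := @is_derive_line _ _ (transition_coord a b q) x (delta_mx 0 l) 0; rewrite E0; apply.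
  exact: smooth_derivable (@smooth_transition _ _ _ a b q) ox.
have dY : is_derive (0 : R) 1 Y (\row_q pd l (fun w => 'D_y (transition_coord a b q) w) x).
  apply/is_derive_rV => q; rewrite mxE /pd.
  have := @is_derive_line _ _ (fun w => 'D_y (transition_coord a b q) w) x (delta_mx 0 l) 0.
  rewrite E0 => /(_ (smooth_derivable (smooth_derive _ (@smooth_transition _ _ _ a b q)) ox)).
  by congr is_derive; apply/funext => s; rewrite /Y mxE.
have dEb : differentiable (E b) (X 0, Y 0).
  by rewrite XY0; exact: smooth_differentiable (smooth_energy fF b) bz.
refine (etrans (derive_along_curve (smooth_derivable (smooth_energy fF a) az) curve dX dY dEb) _).
by rewrite XY0; congr (_ + _); apply: eq_bigr => q _; rewrite mxE.
Qed.

Lemma dy_lincomb (U : set V) p (c : 'I_n -> R) (f : 'I_n -> V -> R) z :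
  open U -> (forall q, smooth U (f q)) -> U z ->
  dy p (fun w => \sum_q c q * f q w) z = \sum_q c q * dy p (f q) z.
Proof.
move=> oU sf Uz; have scf q : smooth U (fun w => c q * f q w).
  by apply: (smooth_mul oU); [exact: smooth_cst|exact: sf].
refine (etrans (derive_bigsum (fun q => smooth_derivable (scf q) Uz)) _).
by apply: eq_bigr => q _; exact: (dy_scale p (c q) Uz (sf q)).
Qed.

(** The Cartan torsion is a tensor along the fibres, hence its vanishing does
    not depend on the chart. *)
Lemma cartan_eq0_transfer a b x y : overlap a b x -> y <> 0 ->
  (forall i j k, cartan (local F b) i j k (tangent_map a b (x, y)) = 0) ->
  forall i j k, cartan (local F a) i j k (x, y) = 0.
Proof.
move=> ox y0 C0 i j k; have oU := @open_slit _ _ M b.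
have az : slit a (x, y) by split=> //; have [pa _ px] := overlapP ox; exists (chart_inv a x).
have bz : slit b (tangent_map a b (x, y)) by exact: slit_tangent_map.
have sa := smooth_energy fF a; have sb := smooth_energy fF b.
pose A l q := pd l (transition_coord a b q) x.
pose g1 := fun w => \sum_r A j r * dy r (E b) w.
pose g2 := fun w => \sum_q A i q * dy q g1 w.
have sg1 : smooth (slit b) g1.
  by apply: (smooth_sum _ _ oU) => r; apply: (smooth_mul oU); [exact: smooth_cst|exact: smooth_dy].
have sg2 : smooth (slit b) g2.
  by apply: (smooth_sum _ _ oU) => r; apply: (smooth_mul oU); [exact: smooth_cst|exact: smooth_dy].
have e1 y' : y' <> 0 -> dy j (E a) (x, y') = g1 (tangent_map a b (x, y')).
  by move=> y'0; exact: energy_dy.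
have e2 := fibre_derive i ox (smooth_dy j sa) sg1 e1.
have e3 := fibre_derive k ox (smooth_dy i (smooth_dy j sa)) sg2 e2 y0.
refine (etrans (cartanE sa i j k az) (etrans (congr1 ( *%R 4^-1) _) (mulr0 _))).
refine (etrans e3 _); apply: big1 => p _; refine (etrans (congr1 ( *%R _) _) (mulr0 _)).
refine (etrans (dy_lincomb p (A i) oU (fun q => smooth_dy q sg1) bz) _).
apply: big1 => q _; refine (etrans (congr1 ( *%R _) _) (mulr0 _)).
refine (etrans (dy_congr oU p bz
  (fun w bw => dy_lincomb q (A j) oU (fun r => smooth_dy r sb) bw)) _).
refine (etrans (dy_lincomb p (A j) oU (fun r => smooth_dy q (smooth_dy r sb)) bz) _).
apply: big1 => r _; refine (etrans (congr1 ( *%R _) _) (mulr0 _)).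
have := esym (etrans (esym (C0 q r p)) (cartanE sb q r p bz)).
by move/eqP; rewrite mulf_eq0 invr_eq0 pnatr_eq0 /= => /eqP.
Qed.

End TransformationLaws.

(** * Geodesics *)

Section GeodesicEquation.
Context {R : realType} {n : nat} {M : manifold R n}.
Local Notation V := ('rV[R]_n * 'rV[R]_n)%type.
Variable F : tfun M.
Hypothesis fF : finsler F.
Implicit Types (a b : chart M) (x y : R -> 'rV[R]_n) (t s : R).
Local Notation E a := (F2 (local F a)).

Local Opaque dx dy.

(** Euler-Lagrange form of the geodesic equation: for a curve with velocity y and
    acceleration v, the hypothesis says that the derivative of dE/dy^l in time
    is dE/dx^l. *)
Lemma euler_lagrange a z (v : 'rV[R]_n) : slit a z ->
  (forall l, \sum_k z.2 0 k * dx k (dy l (E a)) z + \sum_p v 0 p * dy p (dy l (E a)) z =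
             dx l (E a) z) ->
  forall i, v 0 i + 2 * spray (local F a) i z = 0.
Proof.
move=> az el i; have oU := @open_slit _ _ M a.
have sE := smooth_energy fF a; have gU := @metric_unitmx _ _ _ _ fF a.
pose A := \matrix_(i < n, j < n) gmetric (local F a) i j z.
have Aw : A *m (\col_p (v 0 p + 2 * spray (local F a) p z)) = 0.
  apply/matrixP => l c; rewrite !mxE.
  have alg (m u w g e : R) : u + w = e -> g = 2^-1 * (u - e) -> m = 2^-1 * (w + 2 * g) -> m = 0.
    by move=> *; lra.
  apply: alg (el l) (spray_metric gU l az) _.
  have sums (f g m : 'I_n -> R) : (forall p, m p = 2^-1 * (f p + 2 * g p)) ->
      \sum_p m p = 2^-1 * (\sum_p f p + 2 * \sum_p g p).
    by move=> mE; rewrite (mulr_sumr _ _ _ 2) -big_split mulr_sumr; apply: eq_bigr => p _; exact: mE.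
  by apply: sums => p; rewrite !mxE (dy_dy oU p l sE az) dydyE; field.
have := congr1 (mulmx (invmx A)) Aw; rewrite mulKmx ?gU // mulmx0 => /matrixP/(_ i 0).
by rewrite !mxE.
Qed.

Lemma is_derive_geodesic a x y t (f : V -> R) : slit a (x t, y t) ->
  is_derive t 1 x (y t) -> is_derive t 1 y (\row_i (- 2 * spray (local F a) i (x t, y t))) ->
  smooth (slit a) f ->
  is_derive t 1 (fun s => f (x s, y s)) (spray_field (local F a) f (x t, y t)).
Proof.
move=> az dx' dy' sf; have := is_derive_curve dx' dy' (smooth_differentiable sf az).
congr is_derive; rewrite /spray_field; congr (_ + _).
rewrite mulr_sumr -sumrN; apply: eq_bigr => i _.
by rewrite mxE; ring.
Qed.

(** The geodesic equation does not depend on the chart. Its Euler-Lagrange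
    expression transforms linearly: the terms with second derivatives of the
    transition map cancel, because these are symmetric. *)
Lemma geodesic_transfer a b x y t :
  (\forall s \near t, [/\ overlap a b (x s), y s <> 0, is_derive (s : R) 1 x (y s) &
     is_derive (s : R) 1 y (\row_i (- 2 * spray (local F a) i (x s, y s)))]) ->
  let X (s : R) := transition a b (x s) in
  let Y (s : R) := 'D_(y s) (transition a b) (x s) in
  (\forall s \near t, is_derive (s : R) 1 X (Y s)) /\
  exists v : 'rV[R]_n, is_derive t 1 Y v /\
    forall i, v 0 i + 2 * spray (local F b) i (X t, Y t) = 0.
Proof.
move=> H X Y.
have dX (s : R) : overlap a b (x s) -> is_derive s 1 x (y s) -> is_derive s 1 X (Y s).
  move=> ox dx'; exact: is_derive_chain dx' (transition_differentiable ox).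
split; first by apply: filterS H => s [ox _ dx' _]; exact: dX.
have [ot y0 dx' dy'] := nbhs_singleton H.
have at_ : slit a (x t, y t).
  by split=> //; have [pa _ px] := overlapP ot; exists (chart_inv a (x t)).
have bt : slit b (X t, Y t) by exact: (slit_tangent_map (z := (x t, y t))).
have dYt : derivable Y t 1.
  apply/derivable_mxP => i q; rewrite (ord1 i).
  have nY : \forall s \near t, \sum_k y s 0 k * pd k (transition_coord a b q) (x s) = Y s 0 q.
    apply: filterS H => s [os _ _ _]; rewrite /Y (derive_transition _ _ os).
    by rewrite (derive_pd _ (smooth_transition _ _ _) os).
  apply: near_eq_derivable nY _.
  have dk k : is_derive t 1 (fun s => y s 0 k * pd k (transition_coord a b q) (x s))
      (y t 0 k * 'D_(y t) (pd k (transition_coord a b q)) (x t)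
       + pd k (transition_coord a b q) (x t) * (\row_i (- 2 * spray (local F a) i (x t, y t))) 0 k).
    apply: is_derive_mul; first by move/is_derive_rV: dy'; apply.
    apply: is_derive_chain dx' _.
    exact: smooth_differentiable (smooth_derive _ (@smooth_transition _ _ _ a b q)) ot.
  by have [] := is_derive_bigsum (index_enum _) dk.
have dY : is_derive t 1 Y ('D_1 Y t) by exact: DeriveDef.
exists ('D_1 Y t); split=> //; apply: (euler_lagrange bt) => l /=.
have oX := overlap_transition ot.
have := is_derive_curve (dX t ot dx') dY
  (smooth_differentiable (smooth_dy l (smooth_energy fF b)) bt).
case=> _ <-.
(* The momentum dE/dy^l, expressed in the chart a. *)
have near_el : \forall s \near t,
    \sum_q pd l (transition_coord b a q) (X s) * dy q (E a) (x s, y s) = dy l (E b) (X s, Y s).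
  apply: filterS H => s [os ys _ _].
  have Ys : Y s <> 0 by have [] := slit_tangent_map (z := (x s, y s)) os ys.
  have := energy_dy fF l (overlap_transition os) Ys.
  have -> : tangent_map b a (X s, Y s) = (x s, y s) by exact: (tangent_mapK (z := (x s, y s))).
  by move=> ->.
rewrite -(near_eq_derive _ near_el).
have dq q : is_derive t 1 (fun s => pd l (transition_coord b a q) (X s) * dy q (E a) (x s, y s))
   (pd l (transition_coord b a q) (X t) * dx q (E a) (x t, y t)
    + dy q (E a) (x t, y t) * 'D_(Y t) (pd l (transition_coord b a q)) (X t)).
  apply: is_derive_mul.
    apply: is_derive_chain (dX t ot dx') _.
    exact: smooth_differentiable (smooth_derive _ (@smooth_transition _ _ _ b a q)) oX.
  have oU := @open_slit _ _ M a; have sE := smooth_energy fF a.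
  have gU := @metric_unitmx _ _ _ _ fF a; have eE := @euler_energy _ _ _ _ fF a.
  have <- : spray_field (local F a) (dy q (E a)) (x t, y t) = dx q (E a) (x t, y t).
    exact: etrans (spray_field_dyE oU sE gU eE q at_) (esym (dxE oU sE gU eE q at_)).
  exact: is_derive_geodesic at_ dx' dy' (smooth_dy q (smooth_energy fF a)).
have [_ ->] := is_derive_bigsum (index_enum _) dq.
have Yt : Y t <> 0 by case: bt.
rewrite (energy_dx fF l oX Yt).
have -> : tangent_map b a (transition a b (x t), Y t) = (x t, y t).
  exact: (tangent_mapK (z := (x t, y t))).
rewrite -big_split; apply: eq_bigr => q _ /=; congr (_ + _).
refine (etrans (mulrC _ _) (congr1 ( *%R^~ _) _)).
exact (derive_comm (Y t) (delta_mx 0 l) (@open_overlap _ _ _ b a)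
  (@smooth_transition _ _ _ b a q) oX).
Qed.

End GeodesicEquation.

Section GeodesicCurves.
Context {R : realType} {n : nat} {M : manifold R n}.
Local Notation V := ('rV[R]_n * 'rV[R]_n)%type.
Variable F : tfun M.
Hypothesis fF : finsler F.
Implicit Types (a b : chart M) (t s : R).
Local Notation E a := (F2 (local F a)).

Local Opaque dx dy.

Lemma is_derive_ncontinuous (W : normedModType R) (f : R -> W) t v :
  is_derive t 1 f v -> {for t, continuous f}.
Proof. by case=> df _; apply/differentiable_continuous/derivable1_diffP. Qed.

(** A solution of the spray system in the chart a solves the geodesic equation
    in every chart that it meets. *)
Theorem local_geodesic a (z0 : V) : slit a z0 ->
  exists d (c : R -> M), [/\ 0 < d, geodesic F [set t | `|t| < d] c, chart_dom a (c 0),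
    chart_map a (c 0) = z0.1 & derive1 (chart_map a \o c) 0 = z0.2].
Proof.
move=> az; have oU := @open_slit _ _ M a.
pose H (k : 'I_n + 'I_n) (z : V) := match k with
  | inl i => ycoord i z | inr i => - 2 * spray (local F a) i z end.
have sH k : smooth (slit a) (H k).
  case: k => i /=; first exact: smooth_ycoord.
  apply: (smooth_mul oU); first exact: smooth_cst.
  exact (smooth_spray oU (smooth_energy fF a) (@metric_unitmx _ _ _ _ fF a) i).
have [d [x [y [d0 x0 y0 xy]]]] := local_flow oU sH az.
pose c := chart_inv a \o x.
have dx' t : `|t| < d -> is_derive t 1 x (y t).
  move=> /xy[_ + _]; congr is_derive; apply/rowP => i; by rewrite mxE.
have dom t : `|t| < d -> chart_dom a (c t) /\ chart_map a (c t) = x t.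
  by move=> /xy[[[p pa /= px] _] _ _]; rewrite /c /= -px chart_mapK.
have nI t : `|t| < d -> \forall s \near t, `|s| < d.
  move=> td; have : nbhs t (ball t (d - `|t|)) by apply: nbhsx_ballx; rewrite subr_gt0.
  apply: filterS => s; rewrite -ball_normE /= => ts.
  have := ler_normB t (t - s); rewrite opprB addrC subrK => H'.
  by apply: le_lt_trans H' _; rewrite -ltrBrDl.
have nc t : `|t| < d -> {for t, continuous c}.
  move=> td; apply: continuous_comp; first exact: is_derive_ncontinuous (dx' t td).
  by apply: chart_inv_continuous; have [[]] := xy t td.
have z00 : `|0 : R| < d by rewrite normr0.
exists d, c; split=> //.
- move=> t td; split; first exact: nc.
  move=> b bt; set X := chart_map b \o c.
  have [at_ xt] := dom t td.
  have nov : \forall s \near t, overlap a b (x s).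
    have : nbhs (x t) (overlap a b).
      apply: open_nbhs_nbhs; split; first exact: open_overlap.
      by rewrite -xt; exact: overlap_intro.
    by move/(is_derive_ncontinuous (dx' t td)).
  have near_sol : \forall s \near t, [/\ overlap a b (x s), y s <> 0,
      is_derive (s : R) 1 x (y s) &
      is_derive (s : R) 1 y (\row_i (- 2 * spray (local F a) i (x s, y s)))].
    apply: filterS (filterI (nI t td) nov) => s [sd os].
    by have [[_ ys] _ dy'] := xy s sd; split=> //; exact: dx'.
  have [dX [v [dY eqv]]] := geodesic_transfer fF near_sol.
  have XY : \forall s \near t, 'D_(y s) (transition a b) (x s) = derive1 X s.
    by apply: filterS dX => s [_ <-]; rewrite derive1E.
  have [dXt _] := nbhs_singleton dX.
  have [dY1 dY2] := near_eq_is_derive XY dY.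
  have X2 : derive1 (derive1 X) t = v by exact (etrans (derive1E (derive1 X) t) dY2).
  have X1 := esym (nbhs_singleton XY).
  cbv zeta; split; [exact: dXt|exact: dY1|move=> i].
  by rewrite X2 X1; exact: eqv.
- by have [] := dom 0 z00.
- by have [_ ->] := dom 0 z00.
- have nx : \forall s \near (0 : R), x s = (chart_map a \o c) s.
    by apply: filterS (nI 0 z00) => s /dom[].
  rewrite derive1E -(near_eq_derive _ nx); have [_ ->] := dx' 0 z00.
  exact: y0.
Qed.

Section Geodesic.
Variable c : R -> M.
Hypothesis gc : geodesic F setT c.

(** The velocity of c at time t, in the coordinates of the chart a. *)
Definition lift a t : V := (chart_map a (c t), derive1 (chart_map a \o c) t).

Lemma near_dom a t : chart_dom a (c t) -> \forall s \near t, chart_dom a (c s).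
Proof.
move=> at_; have [ct _] := gc (t := t) I.
have : nbhs (c t) (chart_dom a) by apply: open_nbhs_nbhs; split=> //; exact: dom_open.
by move/ct.
Qed.

Lemma lift_is_derive a t : chart_dom a (c t) ->
  is_derive t 1 (chart_map a \o c) (lift a t).2 /\
  is_derive t 1 (derive1 (chart_map a \o c)) (\row_i (- 2 * spray (local F a) i (lift a t))).
Proof.
move=> at_; have [_ /(_ a at_)[d1 d2 eq]] := gc (t := t) I.
split; first exact (DeriveDef d1 (esym (derive1E _ _))).
have acc : derive1 (derive1 (chart_map a \o c)) t = \row_i (- 2 * spray (local F a) i (lift a t)).
  by apply/rowP => i; rewrite mxE mulNr; apply/eqP; rewrite -addr_eq0; apply/eqP; exact: eq.
exact (DeriveDef d2 (etrans (esym (derive1E _ _)) acc)).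
Qed.

Lemma lift_tangent_map a b t : chart_dom a (c t) -> chart_dom b (c t) ->
  lift b t = tangent_map a b (lift a t).
Proof.
move=> at_ bt; have ot := overlap_intro at_ bt.
have E : \forall s \near t, transition a b ((chart_map a \o c) s) = (chart_map b \o c) s.
  by apply: filterS (near_dom at_) => s as_; rewrite /transition /= chart_mapK.
have [d1 _] := lift_is_derive at_.
have := is_derive_chain d1 (transition_differentiable ot).
move=> /(near_eq_is_derive E)[_ DE].
rewrite /tangent_map /lift /= -DE derive1E; congr pair.
by rewrite /transition /= chart_mapK.
Qed.

Lemma lift_slit a t : chart_dom a (c t) -> (lift a t).2 <> 0 -> slit a (lift a t).
Proof. by move=> at_ y0; split=> //; exists (c t). Qed.

Lemma lift_overlap a b t : chart_dom a (c t) -> chart_dom b (c t) -> overlap a b (lift a t).1.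
Proof. exact: overlap_intro. Qed.

End Geodesic.

End GeodesicCurves.

Section Speed.
Context {R : realType} {n : nat} {M : manifold R n}.
Local Notation V := ('rV[R]_n * 'rV[R]_n)%type.
Variable F : tfun M.
Hypothesis fF : finsler F.
Implicit Types (a b : chart M) (t s : R).
Local Notation E a := (F2 (local F a)).

Local Opaque dx dy.

Lemma compact_sphere : compact [set u : 'rV[R]_n | `|u| = 1].
Proof.
apply: bounded_closed_compact.
  exists 1; split; first exact: num_real.
  by move=> r r1 u /= ->; exact: ltW.
have -> : [set u : 'rV[R]_n | `|u| = 1] = (fun u => `|u|) @^-1` [set (1 : R)] by [].
apply: closed_comp; first by move=> u _; exact: norm_continuous.
exact: accessible_closed_set1 (hausdorff_accessible (@norm_hausdorff _ _)) _.
Qed.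

(** A tube around the compact unit sphere over x0. *)
Lemma energy_sphere_bound a x0 : (chart_map a @` chart_dom a) x0 ->
  exists K, \forall x \near x0, forall u : 'rV[R]_n, `|u| = 1 -> E a (x, u) <= K.
Proof.
move=> ax0.
have su u : `|u| = 1 -> slit a (x0, u).
  by move=> u1; split=> //= u0; move/eqP: u1; rewrite u0 normr0 eq_sym oner_eq0.
have cE u : `|u| = 1 -> {for (x0, u), continuous (E a)}.
  by move=> /su; exact: smooth_continuous (smooth_energy fF a).
have [K KP] : exists K, forall u : 'rV[R]_n, `|u| = 1 -> E a (x0, u) <= K.
  have [[u0 u01]|nS] := pselect (exists u : 'rV[R]_n, `|u| = 1); last first.
    by exists 0 => u u1; case: nS; exists u.
  have cf : {within [set u : 'rV[R]_n | `|u| = 1], continuous (fun u => E a (x0, u))}.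
    apply: continuous_in_subspaceT => u; rewrite inE /= => u1.
    apply: (@continuous_comp _ _ _ (fun u => (x0, u)) (E a)); last exact: cE.
    exact: (differentiable_continuous (differentiable_pair (differentiable_cst x0 u) (@ex_diff _ _ _ _ _ id _ _))).
  have [u _ uP] := compact_EVT_max (ex_intro _ u0 u01) compact_sphere cf.
  by exists (E a (x0, u)) => v v1; exact: (uP v (mem_set v1)).
exists (K + 1).
have /compact_near_coveringP := compact_sphere.
move=> /(_ _ (nbhs x0) (fun x u => E a (x, u) <= K + 1)); apply => u /= u1.
have /cvgrPdist_lt/(_ _ ltr01) := cE u u1.
rewrite nearE; case=> -[P Q] /= [Px Qu] PQ.
exists (Q, P) => //= -[v x] /= [Qv Px'].
have := PQ (x, v) (conj Px' Qv) => /= H; have := KP u u1.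
by move: H; rewrite ltr_norml => /andP[H _] H2; lra.
Qed.

Lemma energy_quadratic_bound a x0 : (chart_map a @` chart_dom a) x0 ->
  exists K, \forall x \near x0, forall y : 'rV[R]_n, E a (x, y) <= K * \sum_i y 0 i ^+ 2.
Proof.
move=> /energy_sphere_bound[K KP]; exists `|K|; apply: filterS KP => x xP y.
have [->|y0] := eqVneq y 0.
  rewrite energy_eq0 //; apply: mulr_ge0 => //; apply: sumr_ge0 => i _; exact: sqr_ge0.
have ny : 0 < `|y| by rewrite normr_gt0.
have yE : y = `|y| *: (`|y|^-1 *: y) by rewrite scalerA divff ?gt_eqF // scale1r.
have Ey := etrans (congr1 (fun u => E a (x, u)) yE) (energy_scale fF a x (`|y|^-1 *: y) ny).
rewrite [leLHS]Ey.
have u1 : `| `|y|^-1 *: y | = 1 by rewrite normrZ normfV normr_id mulVf // gt_eqF.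
rewrite mulrC; apply: ler_pM; [exact: sqr_ge0|exact: sqr_ge0| |].
  by apply: le_trans (xP _ u1) _; exact: ler_norm.
have S0 : 0 <= \sum_i y 0 i ^+ 2 by apply: sumr_ge0 => i _; exact: sqr_ge0.
rewrite -[leRHS]sqr_sqrtr // ler_sqr ?nnegrE ?sqrtr_ge0 //.
apply: rV_norm_le; first exact: sqrtr_ge0.
move=> i; rewrite -sqrtr_sqr ler_sqrt // (bigD1 i) //= lerDl.
by apply: sumr_ge0 => j _; exact: sqr_ge0.
Qed.

Lemma is_derive0_squeeze (f q : R -> R) t : (\forall s \near t, 0 <= f s <= q s) ->
  q t = 0 -> is_derive t 1 q 0 -> is_derive t 1 f 0.
Proof.
move=> fq q0 dq.
have f0 : f t = 0.
  by have := nbhs_singleton fq; rewrite q0 => H; apply/eqP; rewrite eq_le andbC.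
have cq : (fun h : R => h^-1 *: ((q \o shift t) (h *: 1) - q t)) @ 0^' --> (0 : R).
  have [dq1 dq2] := dq.
  have H : (fun h : R => h^-1 *: ((q \o shift t) (h *: 1) - q t)) @ 0^' --> 'D_1 q t := dq1.
  by rewrite dq2 in H.
have nfq : \forall h \near (0 : R), 0 <= f (h *: 1 + t) <= q (h *: 1 + t).
  have ch : {for (0 : R), continuous (fun h : R => h *: 1 + t)}.
    by apply: continuousD; [exact: scalel_continuous|exact: cst_continuous].
  have : nbhs ((0 : R) *: 1 + t) (fun s => 0 <= f s <= q s) by rewrite scale0r add0r.
  by move/ch.
have cf : (fun h : R => h^-1 *: ((f \o shift t) (h *: 1) - f t)) @ 0^' --> (0 : R).
  apply/cvgr0Pnorm_le => e e0; move/cvgr0Pnorm_le : cq => /(_ e e0).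
  apply: filter_app; have := nbhs_dnbhs nfq.
  apply: filterS => h /andP[f0h fqh] /=; apply: le_trans.
  rewrite q0 f0 !subr0 !normrZ ler_wpM2l // ger0_norm //.
  exact: le_trans fqh (ler_norm _).
apply: DeriveDef; first by apply/cvg_ex; exists 0.
exact: cvg_lim cf.
Qed.

Variable c : R -> M.
Hypothesis gc : geodesic F setT c.

Definition base_chart (p : M) : chart M := sval (cid (dom_cover p)).
Lemma base_chartP p : chart_dom (base_chart p) p.
Proof. exact: svalP (cid (dom_cover p)). Qed.

(** The energy at time t in a chart chosen at that time; the value is the same in
    all charts around c t. *)
Definition energy_along t := E (base_chart (c t)) (lift c (base_chart (c t)) t).

Lemma energy_alongE a t : chart_dom a (c t) -> energy_along t = E a (lift c a t).
Proof.
move=> at_; have bt := base_chartP (c t).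
rewrite /energy_along (lift_tangent_map gc at_ bt) energy_tangent_map //.
exact: lift_overlap at_ bt.
Qed.

(** At an instant of zero velocity the energy is quadratically small, so its
    derivative vanishes there as well. *)
Lemma is_derive_energy t : is_derive t 1 energy_along 0.
Proof.
pose a := base_chart (c t); have at_ : chart_dom a (c t) by exact: base_chartP.
have near_e : \forall s \near t, E a (lift c a s) = energy_along s.
  by apply: filterS (near_dom gc at_) => s as_; rewrite (energy_alongE as_).
apply: near_eq_is_derive near_e _.
have [dx' dy'] := lift_is_derive gc at_.
have [y0|y0] := pselect ((lift c a t).2 = 0); last first.
  have sl := lift_slit at_ y0; have oU := @open_slit _ _ M a.
  have sE := smooth_energy fF a; have gU := @metric_unitmx _ _ _ _ fF a.
  have := is_derive_geodesic (a := a) sl dx' dy' sE.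
  congr is_derive; rewrite /spray_field.
  have alg (u v : R) : u = v -> u - v = 0 by move=> ->; rewrite subrr.
  exact (alg _ _ (spray_E oU sE gU (@euler_energy _ _ _ _ fF a) sl)).
have [K KP] := energy_quadratic_bound (ex_intro2 _ _ (c t) at_ erefl).
pose q s := K * \sum_i (lift c a s).2 0 i ^+ 2.
have yi0 i : (lift c a t).2 0 i = 0 by rewrite y0 mxE.
apply: (@is_derive0_squeeze _ q).
- have nK : \forall s \near t, forall y : 'rV[R]_n,
      E a ((lift c a s).1, y) <= K * \sum_i y 0 i ^+ 2.
    exact: (is_derive_ncontinuous dx' KP).
  apply: filterS nK => s sP.
  by rewrite sqr_ge0 /=; exact: sP.
- by rewrite /q big1 ?mulr0 // => i _; rewrite yi0 expr0n.
have dq i : is_derive t 1 (fun s => (lift c a s).2 0 i ^+ 2) 0.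
  have di : is_derive t 1 (fun s => (lift c a s).2 0 i)
      ((\row_i (- 2 * spray (local F a) i (lift c a t))) 0 i).
    by move/is_derive_rV: dy'; apply.
  have dii := is_derive_mul di di; rewrite yi0 mul0r addr0 in dii.
  have <- : (fun s => (lift c a s).2 0 i * (lift c a s).2 0 i) =
      (fun s => (lift c a s).2 0 i ^+ 2) by apply/funext => s; rewrite expr2.
  exact: dii.
have := is_derive_mul (is_derive_const K t) (is_derive_bigsum (index_enum _) dq).
by rewrite mulr0 addr0 big1 // mulr0.
Qed.

Lemma energy_constant t s : energy_along t = energy_along s.
Proof.
have le_e (r r' : R) : r <= r' -> energy_along r' = energy_along r.
  move=> rr; have c0 : {within `[r, r'], continuous energy_along}.
    exact: (is_derive_within_continuous (f' := fun=> 0) (fun u _ => is_derive_energy u)).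
  have [u _] := MVT_segment (df := fun=> 0) rr (fun u _ => is_derive_energy u) c0.
  by rewrite mul0r => /eqP; rewrite subr_eq0 => /eqP.
by have [/le_e ->//|/ltW/le_e ->] := leP t s.
Qed.

(** A geodesic that moves at one instant never stops, as its energy is constant.
    Hence it remains in the region where the spray is smooth. *)
Lemma velocity_neq0 a t0 : chart_dom a (c t0) -> (lift c a t0).2 <> 0 ->
  forall b t, chart_dom b (c t) -> (lift c b t).2 <> 0.
Proof.
move=> at0 y0 b t bt E0.
have := energy_gt0 fF (lift_slit at0 y0); rewrite -(energy_alongE at0).
rewrite (energy_constant t0 t) (energy_alongE bt).
have -> : lift c b t = ((lift c b t).1, 0) by rewrite -E0.
by rewrite (energy_eq0 fF b _) ltxx.
Qed.

End Speed.

(** * Transport of the Cartan and Landsberg tensors along a geodesic *)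

(** Gronwall's inequality for the sum of the squares of the unknowns. *)
Lemma linear_system_zero (R : realType) (T : finType) (w w' : T -> R -> R) (K t0 : R) :
  (\forall s \near t0, forall p, is_derive (s : R) (1 : R) (w p) (w' p s) /\
     `|w' p s| <= K * \sum_r `|w r s|) ->
  (forall p, w p t0 = 0) -> \forall s \near t0, forall p, w p s = 0.
Proof.
move=> /nbhs_ballP[d /= d0 dP] w0.
pose q s := \sum_p w p s * w p s.
have q_ge s p : `|w p s| * `|w p s| <= q s.
  rewrite /q (bigD1 p) //= -normrM ger0_norm -?expr2 ?sqr_ge0 // lerDl.
  by apply: sumr_ge0 => r _; rewrite -expr2 sqr_ge0.
have q0 s : 0 <= q s by apply: sumr_ge0 => p _; rewrite -expr2 sqr_ge0.
have prod_le s p r : `|w p s| * `|w r s| <= q s.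
  by have := q_ge s p; have := q_ge s r; have := sqr_ge0 (`|w p s| - `|w r s|); nra.
pose N := \sum_(p : T) \sum_(r : T) (1 : R).
have Q s : `|s - t0| < d -> [/\ is_derive s 1 q (\sum_p (w p s * w' p s + w p s * w' p s)),
    0 <= q s & `|\sum_p (w p s * w' p s + w p s * w' p s)| <= 2 * `|K| * N * q s].
  move=> sd; have sP p : is_derive s 1 (w p) (w' p s) /\ `|w' p s| <= K * \sum_r `|w r s|.
    by apply: dP; rewrite -ball_normE /= distrC.
  split=> //.
    by apply: is_derive_bigsum => p; have [dwp _] := sP p; exact (is_derive_mul dwp dwp).
  apply: le_trans (ler_norm_sum _ _ _) _.
  have -> : 2 * `|K| * N * q s = \sum_(p : T) 2 * (`|K| * ((\sum_(r : T) 1) * q s)).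
    by rewrite -mulr_sumr -mulr_sumr -mulr_suml /N !mulrA.
  apply: ler_sum => p _.
  have [_ bp] := sP p; apply: le_trans (ler_normD _ _) _; rewrite normrM.
  have bp' : `|w' p s| <= `|K| * \sum_r `|w r s|.
    by apply: le_trans bp _; apply: ler_wpM2r (ler_norm _); exact: sumr_ge0.
  have : `|w p s| * `|w' p s| <= `|K| * ((\sum_(r : T) 1) * q s).
    apply: le_trans (ler_wpM2l (normr_ge0 _) bp') _; rewrite mulrCA; apply: ler_wpM2l => //.
    by rewrite mulr_sumr mulr_suml; apply: ler_sum => r _; rewrite mul1r.
  by move: (`|K| * _) => e; lra.
have qt0 : q t0 = 0 by rewrite /q big1 // => p _; rewrite w0 mulr0.
have qz := gronwall_zero Q qt0.
apply/nbhs_ballP; exists d => // s /=; rewrite -ball_normE /= distrC => sd p.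
have := q_ge s p; rewrite (qz s sd) => H; apply/eqP; rewrite -normr_eq0.
by apply/eqP; have := normr_ge0 (w p s); nra.
Qed.

Section Transport.
Context {R : realType} {n : nat} {M : manifold R n}.
Local Notation V := ('rV[R]_n * 'rV[R]_n)%type.
Variables (F mu : tfun M) (c : R -> M).
Hypothesis fF : finsler F.
Hypothesis gc : geodesic F setT c.
Implicit Types (a b : chart M) (t s : R) (i j k m : 'I_n).
Local Notation E a := (F2 (local F a)).
Local Notation factor a z := (- (2^-1 * local mu a z * local F a z)).

Hypothesis velocity0 : forall a t, chart_dom a (c t) -> (lift c a t).2 <> 0.
Hypothesis landsberg_factor : forall a z, slit a z -> forall i j k,
  landsberg (local F a) i j k z = factor a z * cartan (local F a) i j k z.
Hypothesis landsberg_parallel : forall a z, slit a z -> forall i j k,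
  spray_field (local F a) (landsberg (local F a) i j k) z =
  \sum_m landsberg (local F a) m j k z * dy i (spray (local F a) m) z
  + \sum_m landsberg (local F a) i m k z * dy j (spray (local F a) m) z
  + \sum_m landsberg (local F a) i j m z * dy k (spray (local F a) m) z.

Local Opaque dx dy.

(** The combinations of C and L with coefficients affine in time that are
    parallel along c, since C' = L and L' = 0. *)
Definition combination (al be : R) a i j k t : R :=
  al * cartan (local F a) i j k (lift c a t)
  + (be - al * t) * landsberg (local F a) i j k (lift c a t).

Let slit_lift a t : chart_dom a (c t) -> slit a (lift c a t).
Proof. by move=> at_; exact: lift_slit at_ (velocity0 at_). Qed.

Lemma is_derive_combination al be a i j k t : chart_dom a (c t) ->
  let N m l := dy l (spray (local F a) m) (lift c a t) in
  let W i j k := combination al be a i j k t in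
  is_derive t 1 (combination al be a i j k)
    (\sum_m W m j k * N m i + \sum_m W i m k * N m j + \sum_m W i j m * N m k).
Proof.
move=> at_ N W; have sl := slit_lift at_; have oU := @open_slit _ _ M a.
have sE := smooth_energy fF a; have gU := @metric_unitmx _ _ _ _ fF a.
have eE := @euler_energy _ _ _ _ fF a.
have [dx' dy'] := lift_is_derive gc at_.
have dC := is_derive_geodesic sl dx' dy' (smooth_cartan oU sE i j k).
have dL := is_derive_geodesic sl dx' dy' (smooth_landsberg oU sE gU eE i j k).
have dt : is_derive t 1 (fun s => be - al * s) (0 - (al * 1 + t * 0)).
  exact: is_derive_sub (is_derive_const be t)
    (is_derive_mul (is_derive_const al t) (is_derive_ident t)).
have := is_derive_add (is_derive_mul (is_derive_const al t) dC) (is_derive_mul dt dL).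
congr is_derive.
have sums (C L : 'I_n -> R) (v : 'I_n -> R) : \sum_m (al * C m + (be - al * t) * L m) * v m =
    al * \sum_m C m * v m + (be - al * t) * \sum_m L m * v m.
  by rewrite !mulr_sumr -big_split; apply: eq_bigr => m _ /=; ring.
have alg (x x' l c1 c2 c3 l1 l2 l3 s1 s2 s3 u v : R) :
  x = l + c1 + c2 + c3 -> x' = l1 + l2 + l3 ->
  s1 = al * c1 + (be - al * t) * l1 -> s2 = al * c2 + (be - al * t) * l2 ->
  s3 = al * c3 + (be - al * t) * l3 ->
  al * x + v * 0 + ((be - al * t) * x' + l * (0 - (al * 1 + t * 0))) = s1 + s2 + s3.
  by move=> -> -> -> -> ->; ring.
exact (alg _ _ _ _ _ _ _ _ _ _ _ _ 0 _ (cartan_transport oU sE gU eE i j k sl)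
  (landsberg_parallel sl i j k) (sums _ _ _) (sums _ _ _) (sums _ _ _)).
Qed.

(** Since L is a multiple of C by a function on the tangent bundle, the vanishing
    of a combination at a time is the vanishing of a scalar or of C, neither of
    which depends on the chart. *)
Lemma combination_factor al be a i j k t : chart_dom a (c t) -> combination al be a i j k t =
  (al + (be - al * t) * factor a (lift c a t)) * cartan (local F a) i j k (lift c a t).
Proof.
by move=> at_; rewrite /combination (landsberg_factor (slit_lift at_)); ring.
Qed.

Lemma combination_transfer al be a b t : chart_dom a (c t) -> chart_dom b (c t) ->
  (forall i j k, combination al be b i j k t = 0) ->
  forall i j k, combination al be a i j k t = 0.
Proof.
move=> at_ bt Wb i j k; rewrite combination_factor //.
have ot := lift_overlap at_ bt.
have zb := lift_tangent_map gc at_ bt.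
have fE : factor b (lift c b t) = factor a (lift c a t).
  by rewrite zb !local_tangent_map.
have [->|f0] := eqVneq (al + (be - al * t) * factor a (lift c a t)) 0; first by rewrite mul0r.
suff -> : cartan (local F a) i j k (lift c a t) = 0 by rewrite mulr0.
have Cb i' j' k' : cartan (local F b) i' j' k' (tangent_map a b (lift c a t)) = 0.
  have := etrans (esym (combination_factor al be i' j' k' bt)) (Wb i' j' k').
  by rewrite fE zb => /eqP; rewrite mulf_eq0 (negbTE f0) => /eqP.
exact: (cartan_eq0_transfer fF ot (velocity0 at_) Cb i j k).
Qed.

Lemma combination_locally0 al be a t : chart_dom a (c t) ->
  (forall i j k, combination al be a i j k t = 0) ->
  \forall s \near t, forall i j k, combination al be a i j k s = 0.
Proof.
move=> at_ W0.
pose w (p : 'I_n * 'I_n * 'I_n) s := combination al be a p.1.1 p.1.2 p.2 s.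
suff : \forall s \near t, forall p, w p s = 0.
  by apply: filterS => s H i j k; exact: (H (i, j, k)).
have sl := slit_lift at_; have oU := @open_slit _ _ M a.
have sG i : smooth (slit a) (spray (local F a) i).
  exact (smooth_spray oU (smooth_energy fF a) (@metric_unitmx _ _ _ _ fF a) i).
have [K K0 nK] := locally_bounded (fun p : 'I_n * 'I_n =>
  smooth_continuous (smooth_dy p.2 (sG p.1)) sl).
have [dx' dy'] := lift_is_derive gc at_.
have nKt : \forall s \near t, forall p : 'I_n * 'I_n,
    `|dy p.2 (spray (local F a) p.1) (lift c a s)| <= K.
  exact: (is_derive_ncontinuous (is_derive_pair dx' dy') nK).
pose w' (p : 'I_n * 'I_n * 'I_n) s :=
  let N m l := dy l (spray (local F a) m) (lift c a s) in
  let W i j k := combination al be a i j k s in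
  \sum_m W m p.1.2 p.2 * N m p.1.1 + \sum_m W p.1.1 m p.2 * N m p.1.2
  + \sum_m W p.1.1 p.1.2 m * N m p.2.
apply: (@linear_system_zero _ _ w w' (3 * ((\sum_(m < n) 1) * K))); last by move=> p; exact: W0.
apply: filterS (filterI (near_dom gc at_) nKt) => s [as_ Ks] p; split.
  exact: is_derive_combination.
pose S := \sum_r `|w r s|.
have wS i j k : `|combination al be a i j k s| <= S.
  rewrite /S (bigD1 (i, j, k)) //= lerDl; exact: sumr_ge0.
have sumS (W : 'I_n -> R) l : (forall m, `|W m| <= S) ->
    `|\sum_m W m * dy l (spray (local F a) m) (lift c a s)| <= (\sum_(m < n) 1) * K * S.
  move=> WS; apply: le_trans (ler_norm_sum _ _ _) _.
  rewrite -mulrA mulr_suml; apply: ler_sum => m _; rewrite mul1r normrM mulrC.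
  by apply: ler_pM => //; exact: (Ks (m, l)).
have alg (x y z e : R) : `|x| <= e -> `|y| <= e -> `|z| <= e -> `|x + y + z| <= 3 * e.
  move=> xe ye ze; apply: le_trans (ler_normD _ _) _.
  have := ler_normD x y; lra.
rewrite -mulrA; apply: alg; apply: sumS => m; exact: wS.
Qed.

(** The zeros of a combination form an open set, by uniqueness for the linear
    system that it solves, and a closed one, by continuity. *)
Lemma combination_zero al be t0 :
  (exists2 a, chart_dom a (c t0) & forall i j k, combination al be a i j k t0 = 0) ->
  forall a t, chart_dom a (c t) -> forall i j k, combination al be a i j k t = 0.
Proof.
move=> [a0 a0t0 W0].
pose Z := [set t | forall a, chart_dom a (c t) -> forall i j k, combination al be a i j k t = 0].
suff ZT : Z = setT.
  move=> a t; have Zt : Z t by rewrite ZT.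
  exact: Zt.
have Zt0 : Z t0 by move=> a at0; exact: combination_transfer at0 a0t0 W0.
have cR : connected [set: R] by apply/connected_intervalP.
apply: (cR Z); first by exists t0.
- exists Z; last by rewrite setTI.
  rewrite openE => t Zt; have at_ := base_chartP (c t).
  have nW := combination_locally0 at_ (Zt _ at_).
  apply: filterS (filterI (near_dom gc at_) nW) => s [as_ W] b bs.
  exact: combination_transfer bs as_ W.
- exists Z; last by rewrite setTI.
  rewrite -[Z]setCK; apply: open_closedC; rewrite openE => t /existsNP[a /not_implyP[at_]].
  move=> /existsNP[i /existsNP[j /existsNP[k W]]].
  have cW := is_derive_ncontinuous (is_derive_combination al be i j k at_).
  have nW : \forall s \near t, combination al be a i j k s <> 0.
    have : nbhs (combination al be a i j k t) (~` [set 0]).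
      apply: open_nbhs_nbhs; split => //; apply: closed_openC.
      exact: accessible_closed_set1 (hausdorff_accessible (@norm_hausdorff _ _)) _.
    by move/cW.
  by apply: filterS (filterI (near_dom gc at_) nW) => s [as_ Ws] Zs; exact: Ws (Zs a as_ i j k).
Qed.

End Transport.

Section LandsbergAlongGeodesics.
Context {R : realType} {n : nat} {M : manifold R n}.
Variables (F mu lambda : tfun M).
Hypotheses (fF : finsler F) (iso : generalized_isotropic_berwald F mu lambda)
  (str : vanishing_stretch F).

Lemma slit_isotropic a z : slit a z -> forall i j k, landsberg (local F a) i j k z =
  - (2^-1 * local mu a z * local F a z) * cartan (local F a) i j k z.
Proof.
move=> az i j k; have [_ _ hB] := iso.
exact (landsberg_isotropic (@open_slit _ _ M a) (smooth_energy fF a)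
  (@metric_unitmx _ _ _ _ fF a) (@euler_energy _ _ _ _ fF a) (@finsler_neq0 _ _ _ _ fF a)
  (hB a) i j k az).
Qed.

Lemma slit_transport a z : slit a z -> forall i j k,
  spray_field (local F a) (landsberg (local F a) i j k) z =
  \sum_m landsberg (local F a) m j k z * dy i (spray (local F a) m) z
  + \sum_m landsberg (local F a) i m k z * dy j (spray (local F a) m) z
  + \sum_m landsberg (local F a) i j m z * dy k (spray (local F a) m) z.
Proof.
move=> az i j k; have [_ _ hB] := iso.
exact (landsberg_transport (@open_slit _ _ M a) (smooth_energy fF a)
  (@metric_unitmx _ _ _ _ fF a) (@euler_energy _ _ _ _ fF a) (@finsler_neq0 _ _ _ _ fF a)
  (hB a) (str (a := a)) i j k az).
Qed.

End LandsbergAlongGeodesics.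

Theorem theorem1p2 (R : realType) (n : nat) (M : manifold R n)
    (F : tfun M) (mu lambda : tfun M) :
  finsler F -> complete_finsler F ->
  generalized_isotropic_berwald F mu lambda -> bounded_slit mu ->
  vanishing_stretch F ->
  landsberg_metric F.
Proof.
move=> fF complete iso _ str a z az i j k.
have [//|L0] := eqVneq (landsberg (local F a) i j k z) 0.
have [d [c0 [d0 gc0 a0 xz yz]]] := local_geodesic fF az.
have oI : open [set t : R | `|t| < d].
  have -> : [set t : R | `|t| < d] = ball (0 : R) d.
    by apply/seteqP; split=> t; rewrite -ball_normE /= sub0r normrN.
  exact: ball_open.
have iI : is_interval [set t : R | `|t| < d].
  by move=> x y /= xd yd t /andP[xt ty]; move: xd yd; rewrite !ltr_norml => /andP[? ?] /andP[? ?]; apply/andP; split; lra.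
have z0I : [set t : R | `|t| < d] 0 by rewrite /= normr0.
have [c [gc cE]] := complete _ _ (ex_intro _ 0 z0I) oI iI gc0.
have at0 : chart_dom a (c 0) by rewrite cE.
have z0 : lift c a 0 = z.
  rewrite /lift cE // xz; case: z az L0 xz yz => x y _ _ /= _ <-; congr pair.
  rewrite !derive1E; apply: near_eq_derive.
  by apply: filterS (open_nbhs_nbhs (conj oI z0I)) => s /cE /= ->.
have v0 : forall b t, chart_dom b (c t) -> (lift c b t).2 <> 0.
  by apply: (velocity_neq0 fF gc at0); rewrite z0; case: az.
have Lf := slit_isotropic fF iso.
have zero := combination_zero fF gc v0 Lf (slit_transport fF iso str).
pose f := - (2^-1 * local mu a z * local F a z).
have f0 : f != 0 by apply: contra_neq L0 => f0; rewrite Lf // -/f f0 mul0r.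
(* As L = f C at time 0, the combination C + (- f^-1 - t) L vanishes there. *)
have C0 : forall i j k, combination F c 1 (- f^-1) a i j k 0 = 0.
  by move=> i' j' k'; rewrite /combination z0 Lf // -/f; field.
have Ct := zero _ _ _ (ex_intro2 _ _ a at0 C0).
(* At this time the combination reduces to C, and L is a multiple of C. *)
pose t := - f^-1; pose b := base_chart (c t); have bt : chart_dom b (c t) by exact: base_chartP.
have Cb i' j' k' : cartan (local F b) i' j' k' (lift c b t) = 0.
  by have := Ct b t bt i' j' k'; rewrite /combination /t mul1r mul1r subrr mul0r addr0.
have Lb : forall i j k, combination F c 0 1 b i j k t = 0.
  by move=> i' j' k'; rewrite /combination (Lf _ _ (lift_slit bt (v0 b t bt))) Cb !mulr0 addr0.
(* L itself is parallel, so that it vanishes at time 0 as well. *)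
have := zero _ _ _ (ex_intro2 _ _ b bt Lb) a 0 at0 i j k.
by rewrite /combination z0 !mul0r add0r subr0 mul1r.
Qed.
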